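(* Let $A_1,\ldots,A_n$ be finite sets of points in $\mathbb{R}^d$ and let $x\in\mathbb{R}^d$. If $x\in\mathrm{conv}(A_i)$ for all $i\in[n]$ and $n\ge d+2$, then $\mathbf{RG}_{\mathrm{CC}}((A_1,\ldots,A_n),x)$ is connected.
   Context: $\mathbf{RG}_{\mathrm{CC}}((A_1,\ldots,A_n),x)$ is the graph whose vertices are the ordered tuples $(a_1,\ldots,a_n)$ with $a_i\in A_i$ for all $i$ and $x\in\mathrm{conv}(\{a_1,\ldots,a_n\})$; two tuples $(a_1,\ldots,a_n)$ and $(b_1,\ldots,b_n)$ are adjacent if there is a unique index $j$ with $a_j\neq b_j$ and moreover $x\in\mathrm{conv}(\{a_i:i\neq j\})$. *)

(* Defs.v *)
From HB Require Import structures.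
From mathcomp Require Import all_boot all_order all_algebra.
From mathcomp Require Import reals.
Set Implicit Arguments. Unset Strict Implicit. Unset Printing Implicit Defensive.
Import Order.TTheory GRing.Theory Num.Theory.
Local Open Scope ring_scope.

Definition in_conv_fam (R : realType) (d : nat) (I : finType) (P : pred I)
    (f : I -> 'rV[R]_d) (x : 'rV[R]_d) : Prop :=
  exists w : I -> R,
    (forall i, 0 <= w i) /\
    (\sum_(i | P i) w i = 1) /\
    x = \sum_(i | P i) w i *: f i.

Definition in_conv (R : realType) (d : nat) (s : seq 'rV[R]_d)
    (x : 'rV[R]_d) : Prop :=
  in_conv_fam predT (fun k : 'I_(size s) => s`_k) x.

Definition rgcc_vertex (R : realType) (d n : nat) (A : 'I_n -> seq 'rV[R]_d)
    (x : 'rV[R]_d) (a : 'I_n -> 'rV[R]_d) : Prop :=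
  (forall i, a i \in A i) /\ in_conv_fam predT a x.

Definition rgcc_adj (R : realType) (d n : nat) (x : 'rV[R]_d)
    (a b : 'I_n -> 'rV[R]_d) : Prop :=
  exists j : 'I_n,
    a j <> b j /\ (forall i, i != j -> a i = b i) /\
    in_conv_fam (fun i => i != j) a x.

Definition rgcc_connected (R : realType) (d n : nat) (A : 'I_n -> seq 'rV[R]_d)
    (x : 'rV[R]_d) : Prop :=
  forall a b, rgcc_vertex A x a -> rgcc_vertex A x b ->
    exists (k : nat) (p : nat -> 'I_n -> 'rV[R]_d),
      p 0%N = a /\ p k = b /\
      (forall m, (m <= k)%N -> rgcc_vertex A x (p m)) /\
      (forall m, (m < k)%N -> rgcc_adj x (p m) (p m.+1)).

(* Main.v *)
(* After a small perturbation of copies of the points, [x] is interior to the hull of every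
   colour and colourful points are in general position.
   With one colour frozen at a point, tuples containing [x] become tuples of the remaining colours
   whose cone contains a target vector [u].  By induction on the codimension of a subspace [B]
   (working modulo [B]), tuples with [u] in their cone are connected as soon as there are more
   colours than the codimension: every tuple is connected to one whose cone is the whole space;
   for such tuples the connectivity relation is unchanged while [u] moves avoiding [B], because at
   a critical position the possible continuations of a certificate of [u] are connected by
   induction modulo its span; hence the relations for [u] and [- u] agree, and together they
   contain the connectivity relation modulo [B + <u>], which is total by induction.
   Gordan's alternative transfers paths of the perturbed tuples back to the original points. *)
Require Import Defs.
From HB Require Import structures.
From mathcomp Require Import all_boot all_order all_algebra.
From mathcomp Require Import reals.
From mathcomp Require Import boolp.
From mathcomp Require classical_sets.
From mathcomp Require Import ring lra zify.
Import Order.TTheory GRing.Theory Num.Theory.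
Local Open Scope ring_scope.
Set Implicit Arguments.
Unset Strict Implicit.
Unset Printing Implicit Defensive.

(** Freezing a colour costs one of the [d + 2] colours, and the rest must outnumber the codimension.
    In codimension one this leaves two colours, just enough to let one certify the target while the
    other changes. That case needs its own argument: the complement of a hyperplane is disconnected,
    so no motion avoiding it takes a target to its opposite. From codimension two on, a detour
    through a third target always exists.

    General position matters because a tuple with a nontrivial nonnegative relation then has the
    whole space as its cone, so it is an admissible endpoint for every target at once. Motions of
    the target are treated by induction along a real interval, with one threshold for finitely many
    tuples, which replaces a generic path and a list of its critical times.

    Copies are needed because [x] may lie on the boundary of a hull. The two given tuples receive
    copies of their own, so that each can be moved to have [x] inside. *)

Lemma set_ind (X : finType) (Q : {set X} -> Prop) :
  Q set0 -> (forall i (K : {set X}), i \notin K -> Q K -> Q (i |: K)) -> forall K, Q K.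
Proof.
move=> Q0 QS K; have [n] := ubnP #|K|; elim: n K => // n IH K.
have [->//|[i iK]] := set_0Vmem K.
rewrite (cardsD1 i) iK /= ltnS => Kn.
by rewrite -(setD1K iK); apply: QS; [rewrite !inE eqxx | apply: IH].
Qed.

(** * Common thresholds and induction along a real interval *)

Section Small.
Variable R : realType.

Lemma uniform_eps (X : finType) (Q : X -> R -> Prop) :
  (forall x, exists2 e0, 0 < e0 & forall e, 0 < e <= e0 -> Q x e) ->
  exists2 e0, 0 < e0 & forall x e, 0 < e <= e0 -> Q x e.
Proof.
move=> H.
suff [e0 e0p He] : exists2 e0, 0 < e0 &
    forall x, x \in enum X -> forall e, 0 < e <= e0 -> Q x e.
  by exists e0 => // x; apply: He; rewrite mem_enum.
elim: (enum X) => [|x s [e0 e0p IH]]; first by exists 1.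
have [e1 e1p H1] := H x.
exists (Num.min e0 e1); first by rewrite lt_min e0p.
move=> y; rewrite inE => /orP[/eqP-> | ys] e /andP[ep]; rewrite le_min => /andP[l0 l1].
  by apply: H1; rewrite ep.
by apply: IH; rewrite ?ep.
Qed.

(** The supremum of the times where [F] holds is itself such a time by the second hypothesis, and
    cannot be below 1 by the first. The second hypothesis draws [F t] from a single nearby earlier
    time, which is all that a supremum supplies. *)
Lemma real_induction (F : R -> Prop) :
  (forall t, 0 <= t < 1 -> F t ->
     exists2 e0, 0 < e0 & forall e, 0 < e <= e0 -> F (t + e)) ->
  (forall t, 0 < t <= 1 ->
     exists2 e0, 0 < e0 & forall e, 0 < e <= e0 -> F (t - e) -> F t) ->
  F 0 -> F 1.
Proof.
move=> Hr Hl F0.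
pose E : classical_sets.set R := fun t : R => 0 <= t <= 1 /\ F t.
have E0 : E 0 by split; rewrite ?lexx ?ler01.
have Eb : classical_sets.has_ubound E by exists 1 => t [] /andP[].
have hs : classical_sets.has_sup E by split; [exists 0 | ].
have s0 : 0 <= sup E by apply: ub_le_sup.
have s1 : sup E <= 1 by apply: ge_sup; [exists 0 | move=> t [] /andP[]].
have Fs : F (sup E).
  have [/eqP s00|sn0] := boolP (sup E == 0); first by rewrite s00.
  have sp : 0 < sup E by rewrite lt_def sn0.
  have [|e0 e0p He] := Hl (sup E); first by rewrite sp.
  have [t [t01 Ft] tl] := sup_adherent e0p hs.
  have := ub_le_sup Eb (conj t01 Ft); rewrite le_eqVlt => /orP[/eqP<-//|tls].
  apply: (He (sup E - t)); last by rewrite subKr.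
  by rewrite subr_gt0 tls; lra.
have [/eqP <-//|sn1] := boolP (sup E == 1).
have sl : sup E < 1 by rewrite lt_neqAle sn1.
have [|e0 e0p He] := Hr (sup E) _ Fs; first by rewrite s0.
pose e := Num.min e0 (1 - sup E).
have ep : 0 < e by rewrite lt_min e0p subr_gt0.
have Fe : F (sup E + e) by apply: He; rewrite ep ge_min lexx.
have e1 : e <= 1 - sup E by rewrite ge_min lexx orbT.
suff : sup E + e <= sup E by lra.
apply: ub_le_sup => //; split=> //; lra.
Qed.

End Small.

(** * Farkas and cones modulo a subspace *)

Section Cones.
Variables (R : realType) (d : nat).
Local Notation V := 'rV[R]_d.

Definition dot (u : V) (y : 'cV[R]_d) : R := (u *m y) 0 0.

Lemma dotD u v y : dot (u + v) y = dot u y + dot v y.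
Proof. by rewrite /dot mulmxDl mxE. Qed.
Lemma dotZ c u y : dot (c *: u) y = c * dot u y.
Proof. by rewrite /dot -scalemxAl mxE. Qed.
Lemma dotN u y : dot (- u) y = - dot u y.
Proof. by rewrite /dot mulNmx mxE. Qed.
Lemma dotB u v y : dot (u - v) y = dot u y - dot v y.
Proof. by rewrite dotD dotN. Qed.
Lemma dot0 y : dot 0 y = 0.
Proof. by rewrite /dot mul0mx mxE. Qed.
Lemma dotDr u y z : dot u (y + z) = dot u y + dot u z.
Proof. by rewrite /dot mulmxDr mxE. Qed.
Lemma dotZr c u y : dot u (c *: y) = c * dot u y.
Proof. by rewrite /dot -scalemxAr mxE. Qed.
Lemma dot_sum (I : finType) (p : pred I) (F : I -> V) y :
  dot (\sum_(i | p i) F i) y = \sum_(i | p i) dot (F i) y.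
Proof. by rewrite /dot mulmx_suml summxE. Qed.

(** Induction on the generators. If the functional [y] found for the tail is negative on the new
    generator, everything is projected along that generator onto the kernel of [y]; hence [a] and
    [u] vary in the induction. *)
Lemma farkas_seq (X : eqType) (s : seq X) : uniq s -> forall (a : X -> V) (u : V),
  (exists2 w : X -> R, forall i, 0 <= w i & u = \sum_(i <- s) w i *: a i) \/
  (exists2 y, forall i, i \in s -> 0 <= dot (a i) y & dot u y < 0).
Proof.
elim: s => [_ a u|i0 s IH /= /andP[i0s us] a u].
  have [->|un0] := eqVneq u 0; first by left; exists (fun=> 0) => //; rewrite big_nil.
  right; exists (- u^T) => //.
  rewrite /dot mulmxN mxE oppr_lt0 mxE.
  have [k uk] : exists k, u 0 k != 0.
    apply/not_existsP => H; move/eqP: un0; apply; apply/rowP => k; rewrite mxE.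
    by apply/eqP/negbNE/negP/H.
  rewrite (bigD1 k)//= mxE ltr_pwDl //; first by rewrite -expr2 lt_def sqr_ge0 sqrf_eq0 uk.
  by apply: sumr_ge0 => j _; rewrite mxE -expr2 sqr_ge0.
have [[w w0 ->]|[y ys yu]] := IH us a u.
  left; exists (fun i => if i == i0 then 0 else w i) => [i|]; first by case: ifP.
  rewrite big_cons eqxx scale0r add0r; apply: eq_big_seq => i is_.
  by case: eqP => // ei; rewrite -ei is_ in i0s.
have [ay|ay] := leP 0 (dot (a i0) y).
  by right; exists y => // i; rewrite inE => /orP[/eqP->|/ys].
pose pr (x : V) := x - (dot x y / dot (a i0) y) *: a i0.
have [[w w0 wu]|[z zs zu]] := IH us (fun i => pr (a i)) (pr u).
  (* The coefficient of [a i0] that the projection removed; its numerator and denominator are both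
     negative. *)
  left; pose c := (dot u y - \sum_(i <- s) w i * dot (a i) y) / dot (a i0) y.
  exists (fun i => if i == i0 then c else w i) => [i|].
    case: ifP => // _; rewrite /c -mulrNN mulr_ge0 //; last by rewrite -invrN invr_ge0; lra.
    rewrite oppr_ge0 subr_le0 (le_trans (ltW yu)) // big_seq_cond.
    by apply: sumr_ge0 => k /andP[/ys ? _]; rewrite mulr_ge0.
  rewrite big_cons eqxx.
  rewrite (_ : \sum_(_ <- s) _ = \sum_(i <- s) w i *: a i); last first.
    by apply: eq_big_seq => i is_; case: eqP => // ei; rewrite -ei is_ in i0s.
  have -> : u = pr u + (dot u y / dot (a i0) y) *: a i0 by rewrite /pr subrK.
  rewrite wu /pr; under eq_bigr do rewrite scalerBr scalerA mulrA.
  rewrite sumrB -scaler_suml -mulr_suml /c mulrBl scalerBl.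
  by rewrite addrAC [RHS]addrC addrA.
(* The multiple of [y] makes the functional vanish on [a i0]; evaluating it amounts to evaluating
   [z] on the projection. *)
right; exists (z - (dot (a i0) z / dot (a i0) y) *: y).
  have dp x : dot x (z - (dot (a i0) z / dot (a i0) y) *: y) = dot (pr x) z.
    by rewrite /pr dotB dotZ -scaleNr dotDr dotZr mulNr; congr (_ - _); ring.
  move=> i; rewrite dp inE => /orP[/eqP->|/zs//].
  by rewrite /pr divff ?scale1r ?subrr ?dot0 // lt_eqF.
by move: zu; rewrite /pr dotB dotZ -scaleNr dotDr dotZr mulNr => zu; lra.
Qed.

(** Cone membership in the quotient by [B], expressed in the original space so that enlarging [B]
    changes no type. *)
Definition cone (X : finType) (B : 'M[R]_d) (K : {set X}) (a : X -> V) (u : V) :=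
  exists2 w : X -> R, forall i, 0 <= w i & ((u - \sum_(i in K) w i *: a i)%R <= B)%MS.

(** With [B = 0] and points taken relative to [x], this says that [x] lies in their convex hull. *)
Definition zero (X : finType) (B : 'M[R]_d) (K : {set X}) (a : X -> V) :=
  exists2 w : X -> R, (forall i, 0 <= w i) /\ (exists2 i, i \in K & 0 < w i) &
   ((\sum_(i in K) w i *: a i)%R <= B)%MS.

Definition indep (X : finType) (B : 'M[R]_d) (K : {set X}) (a : X -> V) :=
  forall c : X -> R, ((\sum_(i in K) c i *: a i)%R <= B)%MS -> forall i, i \in K -> c i = 0.

Definition ext (X : finType) (B : 'M[R]_d) (K : {set X}) (a : X -> V) : 'M[R]_d :=
  (B + \sum_(i in K) <<a i>>)%MS.

Section Gen.
Variable X : finType.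
Implicit Types (B : 'M[R]_d) (K L : {set X}) (a : X -> V).

Lemma farkas B K a u : ~ cone B K a u ->
  exists y, [/\ B *m y = 0, forall i, i \in K -> 0 <= dot (a i) y & dot u y < 0].
Proof.
move=> nc.
have [[w w0 wu]|[y ys yu]] :=
  farkas_seq (enum_uniq (mem K)) (fun i => a i *m cokermx B) (u *m cokermx B).
  case: nc; exists w => //.
  rewrite big_enum in wu.
  rewrite submxE mulmxBl wu mulmx_suml; apply/eqP.
  by apply/eqP; rewrite subr_eq0; apply/eqP; apply: eq_bigr => i _; rewrite scalemxAl.
exists (cokermx B *m y); split.
- by rewrite mulmxA mulmx_coker mul0mx.
- by move=> i iK; have := ys i; rewrite mem_enum /dot -mulmxA; apply.
- by move: yu; rewrite /dot -mulmxA.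
Qed.

Lemma dot_sub B u y : B *m y = 0 -> (u <= B)%MS -> dot u y = 0.
Proof. by move=> By /submxP[D ->]; rewrite /dot -mulmxA By mulmx0 mxE. Qed.

Lemma cone_dot B K a u y : B *m y = 0 -> (forall i, i \in K -> 0 <= dot (a i) y) ->
  cone B K a u -> 0 <= dot u y.
Proof.
move=> By ys [w w0 wu]; have := dot_sub By wu.
rewrite dotB dot_sum => /eqP; rewrite subr_eq0 => /eqP->.
by apply: sumr_ge0 => i iK; rewrite dotZ mulr_ge0 ?ys.
Qed.

(** Closedness along a line: if [u] is outside, a separating functional also excludes [u + e *: v]
    for all small [e]. *)
Lemma cone_closed B K a u v :
  exists2 e0, 0 < e0 & forall e, 0 < e <= e0 -> cone B K a (u + e *: v) -> cone B K a u.
Proof.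
have [c|nc] := pselect (cone B K a u); first by exists 1.
have [y [By ys yu]] := farkas nc.
have kp : 0 < `|dot v y| + 1 by rewrite ltr_wpDl.
exists (- dot u y / (`|dot v y| + 1) / 2); first by rewrite !divr_gt0 ?oppr_gt0.
move=> e /andP[ep el] /(cone_dot By ys); rewrite dotD dotZ => H; exfalso.
have := ler_norm (dot v y); rewrite -(ler_pM2l ep).
move: el; rewrite ler_pdivlMr // ler_pdivlMr // mulrDr mulr1; lra.
Qed.

Lemma sub_ext B K a u :
  reflect (exists c : X -> R, ((u - \sum_(i in K) c i *: a i)%R <= B)%MS) (u <= ext B K a)%MS.
Proof.
apply: (iffP idP) => [|[c Hc]].
  case/sub_addsmxP => -[u1 u2] /= eu.
  have /sub_sumsmxP [c Hc] : (u2 *m (\sum_(i in K) <<a i>>)%MS <= \sum_(i in K) <<a i>>)%MS.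
    exact: submxMl.
  have H i : exists k : R, c i *m <<a i>>%MS = k *: a i.
    by apply/sub_rVP; rewrite (submx_trans (submxMl _ _)) ?genmxE.
  pose k i := projT1 (cid (H i)).
  exists k; rewrite eu Hc.
  rewrite (eq_bigr (fun i => k i *: a i)); last by move=> i _; rewrite /k; case: cid.
  by rewrite addrK submxMl.
rewrite -(subrK (\sum_(i in K) c i *: a i) u) addmx_sub_adds //.
apply: summx_sub => i iK; apply: (submx_trans (scalemx_sub _ (submx_refl _))).
by apply: (sumsmx_sup i) => //; rewrite genmxE.
Qed.

Lemma rank_add1 (U : 'M[R]_d) (x : V) : ~~ (x <= U)%MS -> \rank (U + x)%MS = (\rank U).+1.
Proof.
move=> nx; apply/eqP; rewrite eqn_leq; apply/andP; split.
  by rewrite (leq_trans (mxrank_adds_leqif _ _)) // -[leqRHS]addn1 leq_add2l rank_leq_row.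
have : (U < U + x)%MS by rewrite ltmxE addsmxSl addsmx_sub submx_refl.
by rewrite ltmxErank => /andP[].
Qed.

Lemma rank_ext B K a : indep B K a -> \rank (ext B K a) = (\rank B + #|K|)%N.
Proof.
elim/(@set_ind X): K => [|i K iK IH].
  by rewrite /ext big_set0 cards0 addn0 addsmx0_id.
move=> ind.
have indK : indep B K a.
  move=> c Hc j jK.
  have := ind (fun j => if j == i then 0 else c j).
  rewrite big_setU1 //= eqxx scale0r add0r.
  rewrite (eq_bigr (fun j => c j *: a j)); last first.
    by move=> l lK; case: eqP => // e; rewrite -e lK in iK.
  move/(_ Hc j); rewrite inE jK orbT => /(_ isT); case: eqP => // e.
  by rewrite -e jK in iK.
rewrite cardsU1 iK addnCA add1n -IH // -(@rank_add1 _ (a i)).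
  rewrite /ext big_setU1 //= [(<<a i>> + _)%MS]addsmxC addsmxA.
  apply: eqmx_rank; apply/eqmxP.
  exact: (adds_eqmx (eqmx_refl _) (genmxE _)).
apply/sub_ext => -[c Hc].
have := ind (fun j => if j == i then 1 else - c j).
rewrite big_setU1 //= eqxx scale1r.
rewrite (eq_bigr (fun j => - (c j *: a j))); last first.
  by move=> l lK; case: eqP => [e|_]; rewrite ?scaleNr // -e lK in iK *.
rewrite sumrN => /(_ Hc i); rewrite setU11 eqxx => /(_ isT) /eqP.
by rewrite oner_eq0.
Qed.

End Gen.
End Cones.

(** * Positive representations, minimal certificates and general position *)

Section Positions.
Variables (R : realType) (d : nat) (X : finType).
Local Notation V := 'rV[R]_d.
Implicit Types (B : 'M[R]_d) (K L : {set X}) (a : X -> V) (u v : V).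

Definition posrep B K a u := exists2 w : X -> R,
  forall i, i \in K -> 0 < w i & ((u - \sum_(i in K) w i *: a i)%R <= B)%MS.

Definition genpos B K a := forall K' : {set X},
  K' \subset K -> (#|K'| + \rank B <= d)%N -> indep B K' a.

Lemma sum_sub (K L : {set X}) (F : X -> V) : K \subset L ->
  \sum_(i in L) (if i \in K then F i else 0) = \sum_(i in K) F i.
Proof.
move=> KL; rewrite -big_mkcondr; apply: eq_bigl => i.
by rewrite andbC; case: (boolP (i \in K)) => //= /(subsetP KL).
Qed.

Lemma sum_subZ (K L : {set X}) (c : X -> R) a : K \subset L ->
  \sum_(i in L) (if i \in K then c i else 0) *: a i = \sum_(i in K) c i *: a i.
Proof.
move=> KL; rewrite -(sum_sub _ KL); apply: eq_bigr => i _.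
by case: ifP => // _; rewrite scale0r.
Qed.

Lemma cone_sub B K L a u : K \subset L -> cone B K a u -> cone B L a u.
Proof.
move=> KL [w w0 Hw]; exists (fun i => if i \in K then w i else 0) => [i|].
  by case: ifP.
by rewrite sum_subZ.
Qed.

Lemma cone_eq B K a b u : {in K, a =1 b} -> cone B K a u -> cone B K b u.
Proof. by move=> ab [w w0 Hw]; exists w => //; rewrite (eq_bigr (fun i => w i *: a i)) // => i /ab->. Qed.

Lemma zero_sub B K L a : K \subset L -> zero B K a -> zero B L a.
Proof.
move=> KL [w [w0 [i iK wi]] Hw]; exists (fun i => if i \in K then w i else 0).
  by split=> [j|]; [case: ifP | exists i; rewrite ?iK // (subsetP KL)].
by rewrite sum_subZ.
Qed.

Lemma zero_eq B K a b : {in K, a =1 b} -> zero B K a -> zero B K b.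
Proof. by move=> ab [w w0 Hw]; exists w => //; rewrite (eq_bigr (fun i => w i *: a i)) // => i /ab->. Qed.

Lemma cone_in B K a u : (u <= B)%MS -> cone B K a u.
Proof.
by move=> uB; exists (fun=> 0) => //; rewrite big1 ?subr0 // => i _; rewrite scale0r.
Qed.

Lemma coneZ B K a u c : 0 <= c -> cone B K a u -> cone B K a (c *: u).
Proof.
move=> c0 [w w0 Hw]; exists (fun i => c * w i) => [i|]; first exact: mulr_ge0.
under eq_bigr do rewrite -scalerA.
by rewrite -scaler_sumr -scalerBr scalemx_sub.
Qed.

Lemma coneD B K a u v : cone B K a u -> cone B K a v -> cone B K a (u + v).
Proof.
move=> [w w0 Hw] [z z0 Hz]; exists (fun i => w i + z i) => [i|]; first exact: addr_ge0.
under eq_bigr do rewrite scalerDl.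
by rewrite big_split /= opprD addrACA addmx_sub.
Qed.

Lemma cone_gen B K a i : i \in K -> cone B K a (a i).
Proof.
move=> iK; exists (fun j => (j == i)%:R) => [j|]; first by case: eqP.
rewrite (bigD1 i) //= eqxx scale1r big1 ?addr0 ?subrr ?sub0mx // => j /andP[_ /negbTE->].
by rewrite scale0r.
Qed.

Lemma zero_cone_opp B K a i : i \in K -> cone B K a (- a i) -> zero B K a.
Proof.
move=> iK [w w0 Hw]; exists (fun j => w j + (j == i)%:R).
  split=> [j|]; first by rewrite addr_ge0 ?ler0n.
  by exists i; rewrite // eqxx ltr_wpDl.
under eq_bigr do rewrite scalerDl.
rewrite big_split /= [X in (_ + X)%R](bigD1 i) //= eqxx scale1r.
rewrite [X in (_ + (_ + X))%R]big1 ?addr0; last by move=> j /andP[_ /negbTE->]; rewrite scale0r.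
by rewrite -eqmx_opp opprD addrC.
Qed.

(** The independent support is the minimal certificate used below: adjoining its span to [B] raises
    the rank by exactly [#|K|]. *)
Lemma caratheodory B J a u : cone B J a u ->
  exists K : {set X}, [/\ K \subset J, posrep B K a u & indep B K a].
Proof.
move=> [w w0 Hw].
have {w w0 Hw}[K KJ [w w0 Hw]] : exists2 K : {set X}, K \subset J & posrep B K a u.
  exists [set i in J | 0 < w i]; first by apply/subsetP => i; rewrite inE => /andP[].
  exists w => [i|]; first by rewrite inE => /andP[].
  move: Hw; rewrite (bigID (fun i => 0 < w i)) /= addrC big1 ?add0r; last first.
    by move=> i /andP[_]; rewrite lt_def w0 andbT negbK => /eqP->; rewrite scale0r.
  by congr (((_ - _)%R <= _)%MS); apply: eq_bigl => i; rewrite inE.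
have [n] := ubnP #|K|; elim: n => // n IH in K KJ w w0 Hw * => Kn.
have [?|ni] := pselect (indep B K a); first by exists K; split=> //; exists w.
have {ni}[c Hc [i iK ci]] : exists2 c : X -> R, ((\sum_(i in K) c i *: a i)%R <= B)%MS &
    exists2 i, i \in K & 0 < c i.
  move/existsNP: ni => [c /not_implyP[Hc /existsNP[i /not_implyP[iK /eqP ci]]]].
  case: (ltP 0 (c i)) => ci0; first by exists c => //; exists i.
  exists (fun i => - c i); first by under eq_bigr do rewrite scaleNr; rewrite sumrN eqmx_opp.
  by exists i => //; rewrite oppr_gt0 lt_neqAle ci.
pose Q := fun j => (j \in K) && (0 < c j).
have Qi : Q i by rewrite /Q iK.
(* The least ratio is the largest multiple of the relation that can be subtracted with weights
   staying nonnegative; it kills the weight of [j]. *)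
case: (Order.TotalTheory.arg_minP (fun j => w j / c j) Qi) => j /andP[jK cj] jmin.
set t := w j / c j in jmin.
have t0 : 0 < t by rewrite divr_gt0 ?w0.
pose w' := fun i => w i - t * c i.
have w'0 l : l \in K -> 0 <= w' l.
  move=> lK; rewrite subr_ge0; case: (ltP 0 (c l)) => cl.
    by rewrite -ler_pdivlMr // jmin // /Q lK.
  by apply: le_trans (ltW (w0 _ lK)); rewrite pmulr_rle0.
have Hw' : ((u - \sum_(i in K) w' i *: a i)%R <= B)%MS.
  rewrite /w'; under eq_bigr do rewrite scalerBl -scalerA.
  by rewrite sumrB -scaler_sumr opprB addrCA addrC addmx_sub // scalemx_sub.
have w'j : w' j = 0 by rewrite /w' /t divfK ?subrr // gt_eqF.
apply: (IH [set l in K | 0 < w' l] _ w').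
- by apply: subset_trans KJ; apply/subsetP => l; rewrite inE => /andP[].
- by move=> l; rewrite inE => /andP[].
- move: Hw'; rewrite (bigID (fun i => 0 < w' i)) /= addrC big1 ?add0r; last first.
    by move=> l /andP[lK]; rewrite lt_def w'0 // andbT negbK => /eqP->; rewrite scale0r.
  by congr (((_ - _)%R <= _)%MS); apply: eq_bigl => l; rewrite inE.
- rewrite (leq_trans _ (ltnSE Kn)) // proper_card // properE; apply/andP; split.
    by apply/subsetP => l; rewrite inE => /andP[].
  by apply/subsetPn; exists j; rewrite // inE w'j ltxx andbF.
Qed.

Lemma posrep_cone B K a u : posrep B K a u -> cone B K a u.
Proof.
move=> [w w0 Hw]; exists (fun i => if i \in K then w i else 0) => [i|].
  by case: ifP => // /w0/ltW.
by rewrite sum_subZ.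
Qed.

(** Reaching [v] modulo the span of [K] costs coefficients of unknown sign on [K]; scaled by a small
    [e], they are absorbed by the strictly positive weights of [u]. *)
Lemma cone_perturb B K L a u v : [disjoint K & L] -> posrep B K a u -> cone (ext B K a) L a v ->
  exists2 e0, 0 < e0 & forall e, 0 < e <= e0 -> cone B (K :|: L) a (u + e *: v).
Proof.
move=> KL [w w0 Hw] [z z0 /sub_ext[c Hc]].
have [i|e0 e0p He] := @uniform_eps R X (fun i e => i \in K -> 0 <= w i + e * c i).
  have [iK|_] := boolP (i \in K); last by exists 1.
  have kp : 0 < `|c i| + 1 by rewrite ltr_wpDl.
  exists (w i / (`|c i| + 1)); first by rewrite divr_gt0 ?w0.
  move=> e /andP[ep]; rewrite ler_pdivlMr // => el _.
  have := ler_norm (- c i); rewrite normrN -(ler_pM2l ep).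
  by move: el; rewrite mulrDr mulr1; lra.
exists e0 => // e ep.
exists (fun i => if i \in K then w i + e * c i else if i \in L then e * z i else 0) => [i|].
  case: ifP => [iK|_]; first exact: He.
  by case: ifP => // _; rewrite mulr_ge0 // ltW //; case/andP: ep.
have disj i : i \in L -> i \in K = false.
  by move=> iL; apply: contraTF KL => iK; apply/pred0Pn; exists i; rewrite /= iK.
rewrite (bigID (mem K)) /=.
rewrite (eq_big (mem K) (fun i => w i *: a i + e *: (c i *: a i))); first last.
- by move=> i /andP[_ ->]; rewrite scalerDl scalerA.
- by move=> i; rewrite !inE; case: (i \in K); rewrite ?andbF.
rewrite [X in u + _ - (_ + X)](eq_big (mem L) (fun i => e *: (z i *: a i))); first last.
- by move=> i /andP[]; rewrite inE => /orP[->//|->] /negbTE->; rewrite scalerA.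
- move=> i; rewrite !inE; case iL : (i \in L); first by rewrite (disj _ iL).
  by case: (i \in K).
rewrite big_split /= -!scaler_sumr -addrA !opprD.
have -> : forall p q r s : V, p + (e *: v + (- q - e *: r - e *: s)) = (p - q) + e *: (v - s - r).
  by move=> p q r s; rewrite !scalerBr !addrA [p + _ - q]addrAC [RHS]addrAC.
by rewrite addmx_sub // scalemx_sub.
Qed.

Lemma ex_subset K n : (n <= #|K|)%N -> exists2 K' : {set X}, K' \subset K & #|K'| = n.
Proof.
move=> nK; exists [set x in take n (enum K)].
  by apply/subsetP => x; rewrite inE => /mem_take; rewrite mem_enum.
rewrite cardsE; have /card_uniqP -> : uniq (take n (enum K)) by rewrite take_uniq ?enum_uniq.
by rewrite size_take -cardE; case: ltngtP nK.
Qed.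

Lemma ext_sub B K L a : K \subset L -> (ext B K a <= ext B L a)%MS.
Proof.
move=> KL; rewrite /ext addsmxS //; apply/sumsmx_subP => i iK.
by rewrite (sumsmx_sup i) // (subsetP KL).
Qed.

Lemma ext_full B K a v : genpos B K a -> (d <= #|K| + \rank B)%N -> (v <= ext B K a)%MS.
Proof.
move=> gK dK.
have rB : (\rank B <= d)%N by exact: rank_leq_row.
have [|K' K'K cK'] := @ex_subset K (d - \rank B)%N; first by rewrite leq_subLR addnC.
have iK' : indep B K' a by apply: gK => //; rewrite cK' subnK.
apply: submx_trans (ext_sub B a K'K); apply: submx_full.
by rewrite /row_full rank_ext // cK' subnKC.
Qed.

(** The support of the relation is dependent, so by general position it is large enough to span
    everything modulo [B]. As [0] is a strictly positive combination of it, a small multiple of any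
    [v] is reachable, and cones are stable under scaling. *)
Lemma genpos_zero B K a v : genpos B K a -> zero B K a -> cone B K a v.
Proof.
move=> gK [w [w0 [i iK wi]] Hw].
pose K' := [set i in K | 0 < w i].
have K'K : K' \subset K by apply/subsetP => j; rewrite inE => /andP[].
have HK' : ((\sum_(i in K') w i *: a i)%R <= B)%MS.
  move: Hw; rewrite (bigID (fun i => 0 < w i)) /= addrC big1 ?add0r; last first.
    by move=> j /andP[_]; rewrite lt_def w0 andbT negbK => /eqP->; rewrite scale0r.
  by congr ((_ <= _)%MS); apply: eq_bigl => j; rewrite inE.
have dK' : (d <= #|K'| + \rank B)%N.
  rewrite leqNgt; apply/negP => /ltnW /(gK _ K'K) /(_ _ HK' i).
  by rewrite inE iK wi => /(_ isT) w_0; rewrite w_0 ltxx in wi.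
have gK' : genpos B K' a by move=> L LK; apply: gK; apply: subset_trans K'K.
have pr : posrep B K' a 0.
  by exists w => [j|]; [rewrite inE => /andP[] | rewrite sub0r eqmx_opp].
have [||e e0 He] := @cone_perturb B K' set0 a 0 v _ pr.
- by rewrite -setI_eq0 setI0.
- exact/cone_in/ext_full.
have := He e; rewrite e0 lexx => /(_ isT); rewrite add0r setU0 => /(@coneZ _ _ _ _ e^-1).
rewrite invr_ge0 scalerA mulVf ?gt_eqF // scale1r => /(_ (ltW e0)).
exact: cone_sub.
Qed.

End Positions.

(** * Exchange moves on tuples *)

Section Moves.
Variables (C T : finType).
Local Notation tup := {ffun C -> T}.
Implicit Types (f g h : tup) (J K L : {set C}) (Q : {set C} -> tup -> Prop).

Definition upd f j t : tup := [ffun i => if i == j then t else f i].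

(** The certificate avoids the exchanged colour, as in the graph, but [f] and [g] may coincide. [Q]
    is abstract to serve both prescribed targets and relations. *)
Definition step J Q f g :=
  exists2 j, j \in J & Q (J :\ j) f /\ {in [set~ j], f =1 g}.

Inductive conn J Q f : tup -> Prop :=
  | conn_refl : conn J Q f f
  | conn_step g h : conn J Q f g -> step J Q g h -> conn J Q f h.

Lemma conn_trans J Q f g h : conn J Q f g -> conn J Q g h -> conn J Q f h.
Proof. by move=> fg; elim=> // g' h' _ fg' st; apply: conn_step fg' st. Qed.

Lemma conn1 J Q f g : step J Q f g -> conn J Q f g.
Proof. by apply: conn_step; apply: conn_refl. Qed.

Lemma conn_off J Q f g : conn J Q f g -> {in ~: J, f =1 g}.
Proof.
elim=> // g' h' _ fg' [j jJ [_ st]] i iJ; rewrite fg' // st // !inE.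
by apply: contraTneq iJ => ->; rewrite inE jJ.
Qed.

(** Paths never leave the tuples that agree with [f] off [J], so [Q] and [Q'] are compared only
    there; this is how a frozen colour outside [J] can contribute to [Q']. *)
Lemma conn_incl J J' Q Q' f g : J \subset J' ->
  (forall j h, j \in J -> {in ~: J, f =1 h} -> Q (J :\ j) h -> Q' (J' :\ j) h) ->
  conn J Q f g -> conn J' Q' f g.
Proof.
move=> JJ H; elim=> [|g' h' fg' IH [j jJ [Qj st]]]; first exact: conn_refl.
apply: (conn_step IH); exists j; first exact: (subsetP JJ).
by split=> //; apply: H Qj => //; apply: conn_off fg'.
Qed.

Definition local Q := forall K f g, {in K, f =1 g} -> Q K f -> Q K g.
Definition monotone Q := forall K L f, K \subset L -> Q K f -> Q L f.

Lemma conn_sym J Q f g : local Q -> conn J Q f g -> conn J Q g f.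
Proof.
move=> lQ; elim=> [|g' h' _ IH [j jJ [Qj st]]]; first exact: conn_refl.
apply: conn_trans IH; apply: conn1; exists j => //; split; last by move=> i /st.
by apply: lQ Qj => i; rewrite !inE => /andP[ij _]; apply: st; rewrite !inE.
Qed.

Lemma conn_inv J Q f g : local Q -> monotone Q -> Q J f -> conn J Q f g -> Q J g.
Proof.
move=> lQ mQ Qf; elim=> // g' h' _ _ [j jJ [Qj st]].
apply: (mQ (J :\ j)); first exact: subsetDl.
by apply: lQ Qj => i; rewrite !inE => /andP[ij _]; apply: st; rewrite !inE.
Qed.

(* Coordinates outside a certifying set [K] are free, so they can be changed one at a time. *)
Lemma conn_fill J K Q f g : local Q -> monotone Q -> K \subset J -> Q K f ->
  {in K, f =1 g} -> {in ~: J, f =1 g} -> conn J Q f g.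
Proof.
move=> lQ mQ KJ.
have [n] := ubnP #|[set i | f i != g i]|; elim: n => // n IH in f * => fgn QK fgK fgJ.
have [e|[i]] := set_0Vmem [set i | f i != g i].
  suff -> : f = g by apply: conn_refl.
  apply/ffunP => i; apply/eqP; have : i \notin [set i | f i != g i] by rewrite e inE.
  by rewrite inE negbK.
rewrite inE => fgi.
have iK : i \notin K by apply: contraNN fgi => /fgK ->.
have iJ : i \in J by apply: contraNT fgi => iJ; rewrite fgJ ?inE.
have fu : {in [set~ i], f =1 upd f i (g i)}.
  by move=> j; rewrite !inE ffunE; case: eqP.
have fK : {in K, f =1 upd f i (g i)}.
  by move=> j jK; apply: fu; rewrite !inE; apply: contraNneq iK => <-.
apply: (@conn_trans _ _ _ (upd f i (g i))).
  apply: conn1; exists i => //; split=> //.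
  by apply: mQ QK; rewrite subsetD1 KJ.
apply: IH.
- rewrite (leq_trans _ (ltnSE fgn)) // proper_card // properE; apply/andP; split.
    by apply/subsetP => j; rewrite !inE ffunE; case: (j =P i) => [->|] //; rewrite eqxx.
  by apply/subsetPn; exists i; rewrite !inE // ffunE eqxx eqxx.
- exact: lQ QK.
- by move=> j jK; rewrite -fK // fgK.
- by move=> j jJ; rewrite ffunE; case: eqP => [->//|_]; apply: fgJ.
Qed.

End Moves.

(** * Colourful Caratheodory theorem modulo a subspace *)

Section Colorful.
Variables (R : realType) (d : nat) (C T : finType) (P : C -> T -> 'rV[R]_d).
Local Notation V := 'rV[R]_d.
Local Notation tup := {ffun C -> T}.
Implicit Types (f g h : tup) (J K L : {set C}) (B : 'M[R]_d) (u v z : V).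

Definition pt f i := P i (f i).
Definition coneT B u K f := cone B K (pt f) u.
Definition zeroT B K f := zero B K (pt f).

Lemma pt_eq K f g : {in K, f =1 g} -> {in K, pt f =1 pt g}.
Proof. by move=> fg i iK; rewrite /pt fg. Qed.

Lemma coneT_local B u : local (coneT B u).
Proof. by move=> K f g /pt_eq fg; apply: cone_eq. Qed.
Lemma coneT_mono B u : monotone (coneT B u).
Proof. by move=> K L f KL; apply: cone_sub. Qed.
Lemma ext_eq B K (a b : C -> V) : {in K, a =1 b} -> ext B K a = ext B K b.
Proof. by move=> ab; rewrite /ext; congr (_ + _)%MS; apply: eq_bigr => i /ab->. Qed.

Lemma posrep_eq B K (a b : C -> V) u : {in K, a =1 b} -> posrep B K a u -> posrep B K b u.
Proof. by move=> ab [w w0 Hw]; exists w => //; rewrite (eq_bigr (fun i => w i *: a i)) // => i /ab->. Qed.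

Hypothesis full : forall j v, cone 0 setT (P j) v.

(** Otherwise every point of colour [j] is congruent modulo [B] to a nonpositive multiple of [u];
    writing [u] as a nonnegative combination of these points puts a positive multiple of [u] in
    [B]. *)
Lemma full_avoid B j u : ~~ (u <= B)%MS ->
  exists t, forall s, 0 <= s -> ~~ ((P j t + s *: u)%R <= B)%MS.
Proof.
move=> uB; apply/not_existsP => H.
have {}H t : exists s, 0 <= s /\ ((P j t + s *: u)%R <= B)%MS.
  move: (H t) => /existsNP[s /not_implyP[s0 /negP]]; rewrite negbK => ?; by exists s.
have [w w0] := full j u; rewrite submx0 subr_eq0 => /eqP wu.
pose s t := projT1 (cid (H t)).
have s0 t : 0 <= s t by rewrite /s; case: cid => ? [].
have sB t : ((P j t + s t *: u)%R <= B)%MS by rewrite /s; case: cid => ? [].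
have : ((\sum_(t in setT) w t *: (P j t + s t *: u))%R <= B)%MS.
  by apply: summx_sub => t _; rewrite scalemx_sub.
under eq_bigr do rewrite scalerDr scalerA.
rewrite big_split /= -wu -scaler_suml -{1}[u]scale1r -scalerDl.
set c := _ + _ => /(scalemx_sub c^-1).
have cp : 0 < c by rewrite ltr_pwDl // sumr_ge0 // => i _; rewrite mulr_ge0.
by rewrite scalerA mulVf ?gt_eqF // scale1r (negbTE uB).
Qed.

(** Before its end, the segment consists of positive multiples of points of the ray [z + s *: u]. *)
Lemma seg_avoid B z u t : ~~ (u <= B)%MS ->
  (forall s, 0 <= s -> ~~ ((z + s *: u)%R <= B)%MS) -> 0 <= t <= 1 ->
  ~~ ((z + t *: (u - z))%R <= B)%MS.
Proof.
move=> uB zu /andP[t0]; rewrite le_eqVlt => /orP[/eqP->|t1].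
  by rewrite scale1r addrC subrK.
have tp : 0 < 1 - t by rewrite subr_gt0.
apply: contra (zu (t / (1 - t)) _) => [H|]; last by rewrite divr_ge0 // ltW.
have := scalemx_sub (1 - t)^-1 H.
have -> : (1 - t)^-1 *: (z + t *: (u - z)) = z + (t / (1 - t)) *: u; last by [].
have -> : z + t *: (u - z) = (1 - t) *: z + t *: u.
  by rewrite scalerBr scalerBl scale1r addrA addrAC.
by rewrite scalerDr !scalerA mulVf ?gt_eqF // scale1r [_ * t]mulrC.
Qed.

(* If the target moves infinitesimally in direction [e], the coordinates in a minimal certificate
   can be kept, since the others only need to reach the direction [e] modulo their span. *)
Lemma cone_extend B J f v e :
  (forall B', (\rank B < \rank B')%N -> forall J', (d <= #|J'| + \rank B')%N ->
     forall f' u, exists2 g : tup, {in ~: J', f' =1 g} & coneT B' u J' g) ->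
  ~~ (v <= B)%MS -> (d <= #|J| + \rank B)%N -> coneT B v J f ->
  exists K (g : tup), [/\ K \subset J, coneT B v K f, {in K :|: ~: J, f =1 g} &
    exists2 e0, 0 < e0 & forall c, 0 < c <= e0 -> coneT B (v + c *: e) J g].
Proof.
move=> CC vB dJ /caratheodory[K [KJ pK iK]].
(* A nonempty certificate is what makes the rank grow, so that the hypothesis applies modulo its
   span. *)
have cK : (0 < #|K|)%N.
  rewrite card_gt0; apply: contraNneq vB => K0; case: pK => w _.
  by rewrite K0 big_set0 subr0.
have cJ : #|J| = (#|K| + #|J :\: K|)%N by rewrite -(cardsID K J) (setIidPr KJ).
have [||g fg Hg] := CC (ext B K (pt f)) _ (J :\: K) _ f e.
- by rewrite rank_ext // -{1}[\rank B]addn0 ltn_add2l.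
- by rewrite rank_ext // (leq_trans dJ) // cJ; lia.
have fgK : {in K, f =1 g} by move=> i iK'; apply: fg; rewrite !inE iK'.
exists K, g; split=> //.
- exact: posrep_cone.
- by move=> i ii; apply: fg; move: ii; rewrite !inE negb_and negbK.
rewrite /coneT in Hg; rewrite (ext_eq _ (pt_eq fgK)) in Hg.
have [|e0 e0p He] := cone_perturb _ (posrep_eq (pt_eq fgK) pK) Hg.
  by rewrite -setI_eq0 setIDA setIC -setIDA setDv setI0.
exists e0 => // c /He; rewrite /coneT.
by apply: cone_sub; apply/subsetP => i; rewrite !inE; case/orP => [/(subsetP KJ)|/andP[]].
Qed.

(** A target equal to a point of colour [j] is certified by any tuple through that point. The target
    then slides to [u] along a segment avoiding [B], with the tuple adjusted by the induction
    hypothesis in smaller codimension. *)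
Lemma colorful_caratheodory B J : (d <= #|J| + \rank B)%N ->
  forall f u, exists2 g : tup, {in ~: J, f =1 g} & coneT B u J g.
Proof.
have [n] := ubnP (d - \rank B)%N; elim: n => // n IH in B J * => Bn dJ f u.
have [uB|uB] := boolP (u <= B)%MS; first by exists f => //; apply: cone_in.
have rB : (\rank B < d)%N.
  rewrite ltn_neqAle rank_leq_row andbT; apply: contra uB => /eqP e.
  by rewrite submx_full // /row_full e.
have [j jJ] : exists j, j \in J.
  by have [J0|[j jJ]] := set_0Vmem J; [move: dJ; rewrite J0 cards0; lia | exists j].
have [t Ht] := full_avoid j uB.
pose z := P j t.
pose F s := exists2 g : tup, {in ~: J, f =1 g} & coneT B (z + s *: (u - z)) J g.
suff : F 1 by case=> g fg; rewrite scale1r addrC subrK; exists g.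
apply: (@real_induction _ F).
- move=> s /andP[s0 s1] [g fg cg].
  have zs : ~~ ((z + s *: (u - z))%R <= B)%MS by rewrite seg_avoid // s0 ltW.
  have [B' rB' J' dJ'|K [h [KJ _ gh [e0 e0p He]]]] := cone_extend (u - z) _ zs dJ cg.
    by apply: IH => //; lia.
  exists e0 => // e ee; exists h.
    by move=> i iJ; rewrite fg // gh // inE iJ orbT.
  by rewrite scalerDl addrA; apply: He.
- move=> s _.
  have [g|e0 e0p He] := @uniform_eps R tup (fun g e =>
      coneT B (z + s *: (u - z) + e *: - (u - z)) J g -> coneT B (z + s *: (u - z)) J g).
    exact: cone_closed.
  exists e0 => // e ee [g fg cg]; exists g => //; apply: (He _ _ ee).
  by rewrite scalerN -addrA -scalerBl.
exists (upd f j t).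
  move=> i; rewrite inE ffunE; case: eqP => // ->; by rewrite jJ.
have <- : pt (upd f j t) j = z + 0 *: (u - z).
  by rewrite /pt ffunE eqxx scale0r addr0.
exact: cone_gen.
Qed.

End Colorful.

(** * Avoiding finitely many subspaces, and relations modulo a span *)

Section Quotients.
Variables (R : realType) (d : nat).
Local Notation V := 'rV[R]_d.

Lemma avoid_subspaces (Y : finType) (U : Y -> 'M[R]_d) (p : V) (e : R) :
  (forall y, (\rank (U y) < d)%N) -> 0 < e ->
  exists u : V, (forall k, `|u 0 k - p 0 k| < e) /\ (forall y, ~~ (u <= U y)%MS).
Proof.
move=> rU e0.
suff H : forall D : {set Y}, exists u : V, (forall k, `|u 0 k - p 0 k| < e) /\
    (forall y, y \in D -> ~~ (u <= U y)%MS).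
  by have [u [up uU]] := H setT; exists u; split=> // y; apply: uU; rewrite inE.
apply: set_ind => [|y D yD [u [up uD]]].
  by exists p; split=> [k|y]; rewrite ?subrr ?normr0 // inE.
have [uy|uy] := boolP (u <= U y)%MS; last first.
  by exists u; split=> // x; rewrite !inE => /orP[/eqP->|/uD].
have [v vy] : exists v : V, ~~ (v <= U y)%MS.
  have : ~~ row_full (U y) by rewrite /row_full ltn_eqF.
  by rewrite -sub1mx => /row_subPn[i]; exists (row i 1%:M).
have [k|e1 e1p H1] := @uniform_eps R 'I_d (fun k c => `|(u + c *: v) 0 k - p 0 k| < e).
  have kp : 0 < `|v 0 k| + 1 by rewrite ltr_wpDl.
  exists ((e - `|u 0 k - p 0 k|) / (`|v 0 k| + 1) / 2); first by rewrite !divr_gt0 ?subr_gt0.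
  move=> c /andP[cp]; rewrite ler_pdivlMr // ler_pdivlMr // mulrDr mulr1 => cl.
  rewrite !mxE addrAC (le_lt_trans (ler_normD _ _)) // normrM (gtr0_norm cp).
  by have := normr_ge0 (v 0 k); rewrite -(pmulr_rge0 _ cp); lra.
have [x|e2 e2p H2] := @uniform_eps R Y (fun x c => ((u + c *: v)%R <= U x)%MS -> (u <= U x)%MS).
  (* Without generators the cone is the subspace itself, so this is closedness of [U x]. *)
  have [e2 e2p H2] := cone_closed (U x) set0 (fun _ : Y => 0) u v.
  exists e2 => // c ce uvx; have [w _] := H2 c ce (cone_in _ _ uvx).
  by rewrite big_set0 subr0.
pose c := Num.min e1 e2.
have cp : 0 < c by rewrite lt_min e1p.
exists (u + c *: v); split=> [k|x]; first by apply: H1; rewrite cp ge_min lexx.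
rewrite !inE => /orP[/eqP->|xD]; last first.
  by apply: contra (uD x xD); apply: H2; rewrite cp ge_min lexx orbT.
apply: contra vy => H.
have : (c *: v <= U y)%MS.
  by rewrite -[X in (X <= _)%MS](addKr u) addmx_sub // eqmx_opp.
by rewrite eqmx_scale // gt_eqF.
Qed.

Variable X : finType.
Implicit Types (B : 'M[R]_d) (J K L : {set X}) (a : X -> V) (u v : V).

Lemma zero_pos B K a : zero B K a -> exists2 i, i \in K & cone B (K :\ i) a (- a i).
Proof.
move=> [w [w0 [i iK wi]] Hw]; exists i => //.
have -> : - a i = (w i)^-1 *: (- (w i *: a i)).
  by rewrite scalerN scalerA mulVf ?scale1r // gt_eqF.
apply: coneZ; first by rewrite invr_ge0.
exists w => //; rewrite -opprD eqmx_opp.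
by rewrite -big_setD1.
Qed.

Lemma zero_opp B K a u : ~~ (u <= B)%MS -> cone B K a u -> cone B K a (- u) -> zero B K a.
Proof.
move=> uB [w w0 Hw] [z z0 Hz]; exists (fun i => w i + z i); last first.
  under eq_bigr do rewrite scalerDl.
  have := addmx_sub Hw Hz.
  by rewrite big_split /= addrACA subrr add0r -opprD eqmx_opp.
split=> [i|]; first exact: addr_ge0.
apply/not_exists2P => H; case/negP: uB.
suff e : \sum_(i in K) w i *: a i = 0 by move: Hw; rewrite e subr0.
apply: big1 => i iK; have := H i; case=> // /negP; rewrite -leNgt => wz.
have -> : w i = 0 by apply: le_anti; rewrite w0 andbT (le_trans _ wz) // lerDl.
by rewrite scale0r.
Qed.

Lemma zero_quot B J K a (w : X -> R) : (forall i, i \in J -> 0 <= w i) ->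
  (exists2 i, i \in J :\: K & 0 < w i) ->
  ((\sum_(i in J) w i *: a i)%R <= ext B K a)%MS -> zero (ext B K a) (J :\: K) a.
Proof.
move=> w0 [i iJK wi] H; exists (fun i => if i \in J then w i else 0).
  split=> [j|]; first by case: ifP => // /w0.
  by exists i => //; move: iJK; rewrite inE => /andP[_ ->].
move: H; rewrite (big_setID K) /= => H.
rewrite (eq_bigr (fun i => w i *: a i)); last by move=> j; rewrite inE => /andP[_ ->].
rewrite -[X in (X <= _)%MS](addKr (\sum_(i in J :&: K) w i *: a i)) addmx_sub // eqmx_opp.
apply: summx_sub => j; rewrite inE => /andP[_ jK]; apply: scalemx_sub.
by rewrite (submx_trans _ (addsmxSr _ _)) // (sumsmx_sup j) // genmxE.
Qed.

(** A relation among the [b i] modulo the span of [K] lifts to a relation modulo [B] for the family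
    glued from [a] on [K] and [b] elsewhere. *)
Lemma genpos_ext B J K a b : K \subset J -> indep B K a ->
  (forall c : X -> V, {in K, c =1 a} -> {in J :\: K, c =1 b} -> genpos B J c) ->
  genpos (ext B K a) (J :\: K) b.
Proof.
move=> KJ iK gJ K' K'J; rewrite rank_ext // => dK' c /sub_ext[c' Hc] i iK'.
have disj j : j \in K' -> j \in K = false.
  by move=> /(subsetP K'J); rewrite inE => /andP[/negbTE].
pose m j := if j \in K then a j else b j.
pose n j := if j \in K then - c' j else c j.
have := gJ m _ _ (K :|: K') _ _ n.
have <- : n i = c i by rewrite /n disj.
apply; rewrite ?inE ?iK' ?orbT //.
- by move=> j jK; rewrite /m jK.
- by move=> j; rewrite inE /m => /andP[/negbTE->].
- by rewrite subUset KJ (subset_trans K'J) ?subsetDl.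
- by rewrite (leq_trans _ dK') // (leq_trans (leq_add (leq_card_setU K K') (leqnn _))) //; lia.
rewrite (eq_bigl [predU K & K']); last by move=> j; rewrite !inE.
rewrite bigU /=; last first.
  by rewrite -setI_eq0; apply/eqP/setP => j; rewrite !inE; apply/negP => /andP[jK /disj]; rewrite jK.
rewrite addrC; move: Hc; congr ((_ <= _)%MS); congr (_ + _).
  by apply: eq_bigr => j jK'; rewrite /n /m disj.
by rewrite -sumrN; apply: eq_bigr => j jK; rewrite /n /m jK scaleNr.
Qed.

End Quotients.

(** * Connectivity of tuples with a prescribed vector in their cone *)

Section Connectivity.
Variables (R : realType) (d : nat) (C T : finType) (P : C -> T -> 'rV[R]_d).
Local Notation V := 'rV[R]_d.
Local Notation tup := {ffun C -> T}.
Implicit Types (f g h : tup) (J K L : {set C}) (B : 'M[R]_d) (u v z : V).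
Local Notation pt := (pt P).
Local Notation coneT := (coneT P).
Local Notation zeroT := (zeroT P).

Hypothesis full : forall j v, cone 0 setT (P j) v.

Definition tuples_genpos B J := forall f, genpos B J (pt f).

Definition cone_connected B J := forall u f g,
  {in ~: J, f =1 g} -> coneT B u J f -> coneT B u J g -> conn J (coneT B u) f g.

Lemma conn_coneT_sym B u J f g : conn J (coneT B u) f g -> conn J (coneT B u) g f.
Proof. by apply: conn_sym; apply: coneT_local. Qed.

Lemma cone_fill B u J K f g : K \subset J -> coneT B u K f -> {in K :|: ~: J, f =1 g} ->
  conn J (coneT B u) f g.
Proof.
move=> KJ cK fg; apply: conn_fill cK _ _ => //.
- exact: coneT_local.
- exact: coneT_mono.
- by move=> i iK; apply: fg; rewrite inE iK.
- by move=> i iJ; apply: fg; rewrite inE iJ orbT.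
Qed.

Lemma gen_sub B J K : K \subset J -> tuples_genpos B J -> tuples_genpos B K.
Proof. by move=> KJ gJ f L LK; apply: gJ; apply: subset_trans KJ. Qed.

Lemma gen_zero B J f u : tuples_genpos B J -> zeroT B J f -> coneT B u J f.
Proof. by move=> gJ; apply: genpos_zero. Qed.

Lemma genpos_eq B J (a b : C -> V) : {in J, a =1 b} -> genpos B J a -> genpos B J b.
Proof.
move=> ab ga K KJ dK c; rewrite (eq_bigr (fun i => c i *: a i)); first exact: ga.
by move=> i /(subsetP KJ)/ab->.
Qed.

Lemma gen_ext B J K f : tuples_genpos B J -> K \subset J -> indep B K (pt f) ->
  tuples_genpos (ext B K (pt f)) (J :\: K).
Proof.
move=> gJ KJ iK g; apply: genpos_ext => // c cf cg.
pose m : tup := [ffun i => if i \in K then f i else g i].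
apply: (@genpos_eq _ _ (pt m)); last exact: gJ.
move=> i iJ; rewrite /pt ffunE; case: ifP => iK'; first by rewrite cf.
by rewrite cg // inE iJ iK'.
Qed.

(** Tuples sharing a frozen point [c] of colour [i] are joined by the hypothesis for the target
    [- P i c]. Two frozen points of different colours occur in a common tuple: the remaining colours
    can reach the negative of their sum, and adding either point back gives the opposite of the
    other. If both colours agree, a further colour [l] mediates. *)
Lemma zero_connected B J :
  (forall i, i \in J -> cone_connected B (J :\ i)) -> (d + 2 <= #|J| + \rank B)%N ->
  forall f g, {in ~: J, f =1 g} -> zeroT B J f -> zeroT B J g -> conn J (zeroT B) f g.
Proof.
move=> SJ dJ f g fg zf zg.
pose good i c h := h i = c /\ coneT B (- P i c) (J :\ i) h.
have same i c h h' : i \in J -> {in ~: J, h =1 h'} -> good i c h -> good i c h' ->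
    conn J (zeroT B) h h'.
  move=> iJ hh [hc ch] [hc' ch'].
  have hh' : {in ~: (J :\ i), h =1 h'}.
    move=> j; rewrite !inE negb_and negbK => /orP[/eqP->|jJ]; first by rewrite hc.
    by apply: hh; rewrite inE.
  apply: conn_incl (SJ i iJ _ _ _ hh' ch ch'); first exact: subsetDl.
  move=> j k; rewrite !inE => /andP[ji jJ] hk ck.
  have ki : k i = c by rewrite -hk ?hc // !inE eqxx.
  apply: (@zero_cone_opp _ _ _ _ _ _ i); first by rewrite !inE eq_sym ji.
  rewrite /pt ki; apply: cone_sub ck.
  by apply/subsetP => l; rewrite !inE => /and3P[-> _ ->].
have meet i c j c' : i \in J -> j \in J -> i != j ->
    exists h, [/\ {in ~: J, f =1 h}, good i c h & good j c' h].
  move=> iJ jJ ij.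
  have [|h fh ch] := colorful_caratheodory full _ (upd (upd f i c) j c') (- (P i c + P j c'))
      (B := B) (J := J :\ i :\ j).
    have := cardsD1 i J; have := cardsD1 j (J :\ i); rewrite !inE iJ jJ eq_sym ij /=; lia.
  have hi : h i = c by rewrite -fh ?ffunE ?(negbTE ij) ?ffunE ?eqxx // !inE eqxx /= andbF.
  have hj : h j = c' by rewrite -fh ?ffunE ?eqxx // !inE eqxx.
  exists h; split.
  - move=> k kJ; rewrite -fh; last by move: kJ; rewrite !inE => /negbTE->; rewrite !andbF.
    rewrite inE in kJ; rewrite !ffunE.
    by case: eqP => [e|_]; [rewrite e jJ in kJ | case: eqP => // e; rewrite e iJ in kJ].
  - split=> //; have -> : - P i c = - (P i c + P j c') + pt h j by rewrite /pt hj opprD subrK.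
    apply: coneD; last by apply: cone_gen; rewrite !inE eq_sym ij.
    by apply: cone_sub ch; apply: subsetDl.
  - split=> //; have -> : - P j c' = - (P i c + P j c') + pt h i.
      by rewrite /pt hi opprD addrAC addNr add0r.
    apply: coneD; last by apply: cone_gen; rewrite !inE ij.
    by apply: cone_sub ch; apply/subsetP => k; rewrite !inE => /and3P[-> _ ->].
have [i iJ ci] := zero_pos zf; have [j jJ cj] := zero_pos zg.
have fi : good i (f i) f by [].
have gj : good j (g j) g by [].
have off k : {in ~: J, f =1 k} -> {in ~: J, k =1 g} by move=> fk l lJ; rewrite -fk // fg.
have [ij|ij] := eqVneq i j; last first.
  have [h [fh hi hj]] := meet i (f i) j (g j) iJ jJ ij.
  by apply: (@conn_trans _ _ _ _ _ h); [apply: (same i (f i)) | apply: (same j (g j)) => //; apply: off].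
subst j.
have [l lJ] : exists l, l \in J :\ i.
  have := cardsD1 i J; rewrite iJ; have := rank_leq_row B.
  by have [->|[l lJ]] := set_0Vmem (J :\ i); [rewrite cards0; lia | exists l].
have [li {}lJ] : l != i /\ l \in J by move: lJ; rewrite !inE => /andP.
have il : i != l by rewrite eq_sym.
have [h [fh hi hl]] := meet i (f i) l (f l) iJ lJ il.
have [k [fk ki kl]] := meet i (g i) l (f l) iJ lJ il.
apply: (@conn_trans _ _ _ _ _ h); first exact: (same i (f i)).
apply: (@conn_trans _ _ _ _ _ k); last by apply: (same i (g i)) => //; apply: off.
by apply: (same l (f l)) => // m mJ; rewrite -fh // fk.
Qed.

(** In a one-dimensional quotient a single point certifies [u] and all other colours are free. If
    both tuples rely on the same colour, a point of another colour is first brought in as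
    certificate. *)
Lemma cone_connected_codim1 B J u f g : \rank B = d.-1 -> (0 < d)%N -> (1 < #|J|)%N ->
  ~~ (u <= B)%MS -> {in ~: J, f =1 g} -> coneT B u J f -> coneT B u J g ->
  conn J (coneT B u) f g.
Proof.
move=> rB d0 J1 uB fg cf cg.
have sing h : coneT B u J h -> exists2 i, i \in J & coneT B u [set i] h.
  move=> /caratheodory[K [KJ pK iK]].
  have [K0|[i iK']] := set_0Vmem K.
    by case/negP: uB; case: pK => w _; rewrite K0 big_set0 subr0.
  exists i; first exact: (subsetP KJ).
  suff -> : [set i] = K by apply: posrep_cone.
  apply/eqP; rewrite eqEcard sub1set iK' cards1.
  by have := rank_leq_row (ext B K (pt h)); rewrite rank_ext // rB; lia.
have diff i j h (k : tup) : i \in J -> j \in J -> i != j -> {in ~: J, h =1 k} ->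
    coneT B u [set i] h -> coneT B u [set j] k -> conn J (coneT B u) h k.
  move=> iJ jJ ij hk ch ck.
  pose m : tup := [ffun l => if l == i then h l else k l].
  apply: (@conn_trans _ _ _ _ _ m).
    apply: (cone_fill _ ch); rewrite ?sub1set // => l; rewrite !inE ffunE.
    by case: eqP => //= _ lJ; rewrite hk // inE.
  apply/conn_coneT_sym; apply: (cone_fill _ ck); rewrite ?sub1set // => l; rewrite !inE ffunE.
  case: (l =P i) => // ->; by rewrite iJ (negbTE ij).
have [i iJ ci] := sing f cf; have [j jJ cj] := sing g cg.
have [ij|ij] := eqVneq i j; last exact: (diff i j).
subst j.
have [l lJ] : exists l, l \in J :\ i.
  have := cardsD1 i J; rewrite iJ.
  by have [->|[l lJ]] := set_0Vmem (J :\ i); [rewrite cards0; lia | exists l].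
have [li {}lJ] : l != i /\ l \in J by move: lJ; rewrite !inE => /andP.
have [|h fh ch] := colorful_caratheodory full _ f u (B := B) (J := [set l]).
  by rewrite cards1 rB; lia.
have fhJ : {in ~: J, f =1 h}.
  by move=> k; rewrite inE => kJ; apply: fh; rewrite !inE; apply: contraNneq kJ => ->.
apply: (@conn_trans _ _ _ _ _ h).
  apply: (cone_fill _ ci); rewrite ?sub1set // => k; rewrite !inE => /orP[/eqP->|kJ].
    by apply: fh; rewrite !inE eq_sym.
  by apply: fhJ; rewrite inE.
by apply: (diff l i) => // k kJ; rewrite -fhJ // fg.
Qed.

End Connectivity.

(** * Moving the target past critical positions *)

Section Rotation.
Variables (R : realType) (d : nat) (C T : finType) (P : C -> T -> 'rV[R]_d).
Local Notation V := 'rV[R]_d.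
Local Notation tup := {ffun C -> T}.
Implicit Types (f g h : tup) (J K L : {set C}) (B : 'M[R]_d) (u v z : V).
Local Notation pt := (pt P).
Local Notation coneT := (coneT P).
Local Notation zeroT := (zeroT P).
Local Notation tuples_genpos := (tuples_genpos P).
Local Notation cone_connected := (cone_connected P).

Hypothesis full : forall j v, cone 0 setT (P j) v.

Variables (B : 'M[R]_d) (J : {set C}).
Hypothesis genJ : tuples_genpos B J.
Hypothesis cardJ : (d + 1 <= #|J| + \rank B)%N.
Hypothesis IH : forall B' J', (\rank B < \rank B')%N -> tuples_genpos B' J' ->
  (d + 1 <= #|J'| + \rank B')%N -> cone_connected B' J'.

Let minrep u f K := [/\ K \subset J, posrep B K (pt f) u & indep B K (pt f)].

Lemma minrep_card u f K : ~~ (u <= B)%MS -> minrep u f K -> (0 < #|K|)%N.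
Proof.
move=> uB [_ [w _ Hw] _]; rewrite card_gt0; apply: contraNneq uB => K0.
by move: Hw; rewrite K0 big_set0 subr0.
Qed.

(** An independent [K] cannot carry a relation alone, so some positive weight lies outside it and
    survives in the quotient. *)
Lemma zero_ext u f K : minrep u f K -> zeroT B J f -> zeroT (ext B K (pt f)) (J :\: K) f.
Proof.
move=> [KJ _ iK] [w [w0 [i iJ wi]] Hw]; apply: (@zero_quot _ _ _ _ _ _ _ w) => //.
  have [iK'|iK'] := boolP (i \in K); last by exists i; rewrite // inE iK'.
  apply/not_exists2P => H.
  have wz j : j \in J -> j \notin K -> w j = 0.
    move=> jJ jK; apply: le_anti; rewrite w0 andbT leNgt; apply/negP => wj.
    by case: (H j) => //; rewrite inE jK.
  have := iK w _ i iK'; rewrite (_ : \sum_(j in K) w j *: pt f j = \sum_(j in J) w j *: pt f j).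
    by move=> /(_ Hw) wi0; rewrite wi0 ltxx in wi.
  rewrite [RHS](big_setID K) /= (setIidPr KJ) [X in _ = _ + X]big1 ?addr0 //.
  by move=> j; rewrite inE => /andP[jK jJ]; rewrite wz // scale0r.
exact: submx_trans Hw (addsmxSl _ _).
Qed.

Lemma posrep_ext u f K : posrep B K (pt f) u -> (u <= ext B K (pt f))%MS.
Proof. by move=> [w _ Hw]; apply/sub_ext; exists w. Qed.

(** If [K'] were inside [K], independence would force equality. So [K'] has points outside [K], and
    since [u] is in the span of [K] modulo [B], these satisfy a positive relation in the
    quotient. *)
Lemma zero_ext2 u f K K' : minrep u f K -> minrep u f K' -> K != K' ->
  zeroT (ext B K (pt f)) (J :\: K) f.
Proof.
move=> [KJ pK iK] [KJ' [w w0 Hw] iK'] KK'.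
apply: (@zero_quot _ _ _ _ _ _ _ (fun i => if i \in K' then w i else 0)).
- by move=> i _; case: ifP => // /w0/ltW.
- have [K'K|/subsetPn[i iK'' niK]] := boolP (K' \subset K); last first.
    by exists i; rewrite ?inE ?niK ?(subsetP KJ') // iK'' w0.
  case: pK => z z0 Hz; case/eqP: KK'; apply/eqP; rewrite eqEsubset K'K andbT.
  apply/subsetP => i iKi; apply: contraT => iK''.
  have := iK (fun j => z j - (if j \in K' then w j else 0)) _ i iKi.
  rewrite (negbTE iK'') subr0 => zi; have := z0 i iKi; rewrite zi ?ltxx //.
  under eq_bigr do rewrite scalerBl.
  rewrite sumrB (sum_subZ _ _ K'K).
  set a := \sum_(j in K) _; set b := \sum_(j in K') _.
  have -> : a - b = (u - b) - (u - a) by rewrite opprB [RHS]addrC addrA subrK.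
  by rewrite addmx_sub // eqmx_opp.
- rewrite (sum_subZ _ _ KJ').
  have -> : \sum_(i in K') w i *: pt f i = u - (u - \sum_(i in K') w i *: pt f i) by rewrite subKr.
  apply: addmx_sub; first exact: posrep_ext.
  rewrite eqmx_opp.
  exact: submx_trans Hw (addsmxSl _ _).
Qed.

(** A continuation of the certificate [K]: by [cone_perturb], such a [g] still has the target in its
    cone after a small move in direction [e]. *)
Let good e f K g := {in K :|: ~: J, f =1 g} /\ coneT (ext B K (pt f)) e (J :\: K) g.

Lemma good_refl u e f K : minrep u f K -> zeroT (ext B K (pt f)) (J :\: K) f -> good e f K f.
Proof.
move=> [KJ _ iK] zf; split=> //; apply: (gen_zero _ _ zf).
exact: gen_ext.
Qed.

Lemma exists_good u e f K : minrep u f K -> exists g, good e f K g.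
Proof.
move=> [KJ _ iK].
have cJ : #|J| = (#|K| + #|J :\: K|)%N by rewrite -(cardsID K J) (setIidPr KJ).
have [|g fg cg] := colorful_caratheodory full _ f e (B := ext B K (pt f)) (J := J :\: K).
  by rewrite rank_ext //; move: cardJ; lia.
exists g; split=> // i; rewrite !inE => ii; apply: fg.
by rewrite !inE negb_and negbK.
Qed.

Lemma exists_minrep u f : coneT B u J f -> exists K, minrep u f K.
Proof. by move=> /caratheodory[K [KJ pK iK]]; exists K. Qed.

(** Tuples on a path for [u] may lose the target when it moves, so they are replaced by
    continuations of their certificates. The two ends need no replacement: having a relation, they
    continue their own certificates. *)
Lemma conn_perturb u e : ~~ (u <= B)%MS ->
  exists2 e0, 0 < e0 & forall c, 0 < c <= e0 -> forall f g,
    zeroT B J f -> zeroT B J g -> conn J (coneT B u) f g -> conn J (coneT B (u + c *: e)) f g.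
Proof.
move=> uB.
have [[[K L] g]|e0 e0p He] := @uniform_eps R ({set C} * {set C} * tup)%type (fun x c =>
    [disjoint x.1.1 & x.1.2] -> posrep B x.1.1 (pt x.2) u ->
    cone (ext B x.1.1 (pt x.2)) x.1.2 (pt x.2) e ->
    coneT B (u + c *: e) (x.1.1 :|: x.1.2) x.2).
  rewrite /=.
  have [[dKL [pK cL]]|nH] := pselect ([disjoint K & L] /\ posrep B K (pt g) u /\
      cone (ext B K (pt g)) L (pt g) e).
    by have [e0 e0p He] := cone_perturb dKL pK cL; exists e0 => // c ce _ _ _; apply: He.
  by exists 1 => // c _ H1 H2 H3; case: nH.
exists e0 => // c ce f f' zf zf' ff'.
have same h K g g' : minrep u h K -> good e h K g -> good e h K g' ->
    conn J (coneT B (u + c *: e)) g g'.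
  move=> mK [hg cg] [hg' cg']; have [KJ pK iK] := mK.
  have cJ : #|J| = (#|K| + #|J :\: K|)%N by rewrite -(cardsID K J) (setIidPr KJ).
  have K0 := minrep_card uB mK.
  have SK : cone_connected (ext B K (pt h)) (J :\: K).
    by apply: IH; rewrite ?rank_ext //; [lia | exact: gen_ext | move: cardJ; lia].
  have gg' : {in ~: (J :\: K), g =1 g'}.
    move=> i; rewrite !inE negb_and negbK => iKJ.
    by rewrite -hg -?hg' // !inE.
  apply: conn_incl (SK _ _ _ gg' cg cg'); first exact: subsetDl.
  move=> j k; rewrite !inE => /andP[jK jJ] gk ck.
  have hk : {in K, h =1 k}.
    by move=> i ii; rewrite hg ?gk // !inE ii.
  have := He (K, (J :\: K) :\ j, k) c ce.
  rewrite /= -(ext_eq _ (pt_eq P hk)) => Hk.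
  apply: (@coneT_mono _ _ _ _ P _ _ (K :|: (J :\: K) :\ j)).
    apply/subsetP => i; rewrite !inE => /orP[ii|/and3P[-> _ ->]//].
    by rewrite (subsetP KJ) // andbT; apply: contraNneq jK => <-.
  apply: Hk => //; last exact: posrep_eq (pt_eq P hk) pK.
  by rewrite -setI_eq0; apply/eqP/setP => i; rewrite !inE; case: (i \in K); rewrite ?andbF.
(* Invariant along the old path: for the moved target, [f] reaches every continuation of every
   minimal certificate of the current tuple. *)
suff H h0 : conn J (coneT B u) f h0 -> forall K g, minrep u h0 K -> good e h0 K g ->
    conn J (coneT B (u + c *: e)) f g.
  have [K mK] := exists_minrep (gen_zero u genJ zf').
  apply: (H _ ff' K) => //; apply: good_refl (mK) _; exact: zero_ext mK zf'.
elim=> [K g mK gg|h k fh IHh [j jJ [cj hk]] K g mK gg].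
  apply: (same f K) => //; apply: good_refl (mK) _; exact: zero_ext mK zf.
have [K0 [K0J pK0 iK0]] := caratheodory cj.
have mh : minrep u h K0 by split=> //; apply: subset_trans K0J (subsetDl _ _).
have hk0 : {in K0, h =1 k}.
  by move=> i /(subsetP K0J); rewrite !inE => /andP[ij _]; apply: hk; rewrite !inE.
have mk : minrep u k K0.
  split; first by case: mh.
    exact: posrep_eq (pt_eq P hk0) pK0.
  move=> x; rewrite (eq_bigr (fun i => x i *: pt h i)); first exact: iK0.
  by move=> i ii; rewrite (pt_eq P hk0).
have [m [hm cm]] := exists_good e mh.
have gm : good e k K0 m.
  split; last by rewrite -(ext_eq _ (pt_eq P hk0)).
  move=> i ii; rewrite -hm //; symmetry; apply: hk; move: ii; rewrite !inE => /orP[/(subsetP K0J)|].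
    by rewrite !inE => /andP[].
  by apply: contraNneq => ->.
apply: (conn_trans (IHh K0 m mh (conj hm cm))).
(* If [k] has two different certificates, it is a continuation of both and links their classes. *)
have [eK|nK] := eqVneq K0 K; first by subst K; apply: (same k K0).
apply: (@conn_trans _ _ _ _ _ k).
  apply: (same k K0) => //; apply: good_refl (mk) _; exact: zero_ext2 mk mK nK.
apply: (same k K) => //; apply: good_refl (mK) _; apply: (zero_ext2 mK mk).
by rewrite eq_sym.
Qed.

Lemma conn_rotate z u f g : ~~ (u <= B)%MS ->
  (forall s, 0 <= s -> ~~ ((z + s *: u)%R <= B)%MS) ->
  zeroT B J f -> zeroT B J g -> conn J (coneT B z) f g -> conn J (coneT B u) f g.
Proof.
move=> uB zu zf zg czu.
pose F s := conn J (coneT B (z + s *: (u - z))) f g.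
suff : F 1 by rewrite /F scale1r addrC subrK.
apply: (@real_induction _ F); last by rewrite /F scale0r addr0.
- move=> s /andP[s0 s1] Fs.
  have zs : ~~ ((z + s *: (u - z))%R <= B)%MS by rewrite seg_avoid // s0 ltW.
  have [e0 e0p He] := conn_perturb (u - z) zs.
  by exists e0 => // e ee; rewrite /F scalerDl addrA; apply: He.
- move=> s _.
  have [[K h]|e0 e0p He] := @uniform_eps R ({set C} * tup)%type (fun x e =>
      coneT B (z + s *: (u - z) + e *: - (u - z)) x.1 x.2 ->
      coneT B (z + s *: (u - z)) x.1 x.2).
    exact: cone_closed.
  exists e0 => // e ee; apply: conn_incl => // j h _ _ ch.
  apply: (He (_, _) e ee); rewrite /=.
  by rewrite scalerN -addrA -scalerBl.
Qed.

(** The direct segment may meet [B], for instance when [u = - z]. In codimension at least two some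
    [v] lies outside both [B + <<z>>] and [B + <<u>>], and both legs through it avoid [B]. *)
Lemma conn_change_target z u f g : (\rank B + 2 <= d)%N -> ~~ (z <= B)%MS -> ~~ (u <= B)%MS ->
  zeroT B J f -> zeroT B J g -> conn J (coneT B z) f g -> conn J (coneT B u) f g.
Proof.
move=> dB zB uB zf zg.
have [|v [_ vU]] := @avoid_subspaces R d bool
    (fun b => if b then (B + <<z>>)%MS else (B + <<u>>)%MS) 0 1 _ ltr01.
  move=> b; have r (x : V) : (\rank (B + <<x>>)%MS < d)%N.
    rewrite (leq_ltn_trans (mxrank_adds_leqif _ _)) // genmxE.
    by have := rank_leq_row x; lia.
  by case: b.
have vz := vU true; have vu := vU false; rewrite /= in vz vu.
have vB : ~~ (v <= B)%MS by apply: contra vz => /submx_trans; apply; apply: addsmxSl.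
move=> czz; apply: (@conn_rotate v u) => //.
  move=> s _; apply: contra vu => H.
  rewrite -(addrK (s *: u) v) addmx_sub ?(submx_trans H (addsmxSl _ _)) // eqmx_opp.
  by rewrite scalemx_sub // (submx_trans _ (addsmxSr _ _)) // genmxE.
apply: (@conn_rotate z v) => // s; rewrite le_eqVlt => /orP[/eqP<-|s0].
  by rewrite scale0r addr0.
apply: contra vz => H.
rewrite -(eqmx_scale _ (lt0r_neq0 s0)) -(addKr z (s *: v)) addmx_sub ?(submx_trans H (addsmxSl _ _)) //.
by rewrite eqmx_opp (submx_trans _ (addsmxSr _ _)) // genmxE.
Qed.

End Rotation.

(** * The induction on codimension *)

Section Generic.
Variables (R : realType) (d : nat) (C T : finType) (P : C -> T -> 'rV[R]_d).
Local Notation V := 'rV[R]_d.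
Local Notation tup := {ffun C -> T}.
Implicit Types (f g h : tup) (J K L : {set C}) (B : 'M[R]_d) (u v z : V).
Local Notation pt := (pt P).
Local Notation coneT := (coneT P).
Local Notation zeroT := (zeroT P).
Local Notation tuples_genpos := (tuples_genpos P).
Local Notation cone_connected := (cone_connected P).

Hypothesis full : forall j v, cone 0 setT (P j) v.

Lemma cone_extend_any B J f v e : (d <= #|J| + \rank B)%N -> coneT B v J f ->
  exists K (g : tup), [/\ K \subset J, coneT B v K f, {in K :|: ~: J, f =1 g} &
    exists2 e0, 0 < e0 & forall c, 0 < c <= e0 -> coneT B (v + c *: e) J g].
Proof.
move=> dJ cf; have [vB|vB] := boolP (v <= B)%MS; last first.
  by apply: cone_extend => // B' _ J' dJ' f' u; apply: colorful_caratheodory.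
have [g fg cg] := colorful_caratheodory full dJ f e.
exists set0, g; split; rewrite ?sub0set ?set0U //; first exact: cone_in.
exists 1 => // c /andP[c0 _]; apply: coneD; first exact: cone_in.
by apply: coneZ cg; apply: ltW.
Qed.

(* Keep the point [a] of one colour fixed and move the target of the other colours from
   [u - w a] to [- a]; the point [a] then certifies every exchange made along the way. *)
Lemma conn_zero B J u f : (d + 1 <= #|J| + \rank B)%N -> ~~ (u <= B)%MS -> coneT B u J f ->
  exists2 g, zeroT B J g & conn J (coneT B u) f g.
Proof.
move=> dJ uB cf.
have [i iJ] : exists i, i \in J.
  have := rank_leq_row B; have [J0|[i iJ]] := set_0Vmem J; first by move: dJ; rewrite J0 cards0; lia.
  by exists i.
have dJi : (d <= #|J :\ i| + \rank B)%N by have := cardsD1 i J; rewrite iJ; lia.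
have [w w0 Hw] := cf.
pose a := P i (f i); pose z := u - w i *: a; pose y := - a.
pose F s := exists g, [/\ g i = f i, conn J (coneT B u) f g &
  coneT B (z + s *: (y - z)) (J :\ i) g].
suff : F 1.
  case=> g [gi fg]; rewrite scale1r addrC subrK => cg; exists g => //.
  by apply: (zero_cone_opp iJ); rewrite /pt gi; apply: cone_sub cg; apply: subsetDl.
apply: (@real_induction _ F).
- move=> s /andP[s0 s1] [g [gi fg cg]].
  have [K [h [KJ cK gh [e0 e0p He]]]] := cone_extend_any (y - z) dJi cg.
  exists e0 => // e ee; exists h; split.
  + by rewrite -gh ?gi // !inE eqxx orbT.
  + apply: conn_trans fg _; apply: (@cone_fill _ _ _ _ _ _ _ _ (i |: K)).
    * by rewrite subUset sub1set iJ (subset_trans KJ) ?subsetDl.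
    * have s1p : 0 < 1 - s by rewrite subr_gt0.
      have -> : u = (1 - s)^-1 *: (z + s *: (y - z)) + (w i + s / (1 - s)) *: pt g i.
        have -> : z + s *: (y - z) = (1 - s) *: (u - (w i + s / (1 - s)) *: a).
          apply/rowP => k; rewrite /y /z !mxE; field; lra.
        by rewrite scalerA mulVf ?gt_eqF // scale1r /pt gi subrK.
      apply: coneD; apply: coneZ; first by rewrite invr_ge0 ltW.
      - by apply: cone_sub cK; apply: subsetUr.
      - by rewrite addr_ge0 // divr_ge0 // ltW.
      - by apply: cone_gen; rewrite setU11.
    * move=> j; rewrite !inE => /orP[/orP[/eqP->|jK]|jJ]; apply: gh; rewrite !inE ?eqxx ?orbT ?jK //.
      by rewrite (negbTE jJ) andbF orbT.
  + by rewrite scalerDl addrA; apply: He.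
- move=> s _.
  have [h|e0 e0p He] := @uniform_eps R tup (fun h e =>
      coneT B (z + s *: (y - z) + e *: - (y - z)) (J :\ i) h ->
      coneT B (z + s *: (y - z)) (J :\ i) h).
    exact: cone_closed.
  exists e0 => // e ee [g [gi fg cg]]; exists g; split=> //; apply: (He _ _ ee).
  by rewrite scalerN -addrA -scalerBl.
exists f; split=> //; first exact: conn_refl.
rewrite scale0r addr0; exists w => //.
move: Hw; rewrite (big_setD1 i) //= opprD addrA; congr ((_ <= _)%MS).
Qed.

(** It suffices to avoid the spans of [B] with fewer than [d - \rank B] points of a tuple, which are
    finitely many proper subspaces. The index [None] stands for [B] itself. *)
Lemma gen_addsmx B J : tuples_genpos B J -> (\rank B < d)%N ->
  exists2 u : V, ~~ (u <= B)%MS & tuples_genpos (B + <<u>>)%MS J.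
Proof.
move=> gJ rB.
pose U (x : option (tup * {set C})) : 'M[R]_d :=
  if x is Some (f, K) then
    if (K \subset J) && (#|K| + \rank B < d)%N then ext B K (pt f) else B
  else B.
have [|u [_ uU]] := @avoid_subspaces R d _ U 0 1 _ ltr01.
  move=> [[f K]|//]; rewrite /U; case: ifP => // /andP[KJ dK].
  by rewrite rank_ext 1?addnC //; apply: gJ; rewrite // ltnW.
have uB := uU None; rewrite /= in uB.
exists u => // f K KJ; rewrite (_ : \rank (B + <<u>>)%MS = (\rank B).+1); last first.
  by rewrite -(rank_add1 uB); apply: eqmx_rank; apply/eqmxP; apply: adds_eqmx => //; apply: genmxE.
rewrite addnS => dK c /sub_addsmxP[[D1 D2] /= Hc] i iK.
have iBK : indep B K (pt f) by apply: gJ => //; apply: ltnW.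
have [l Hl] : exists l : R, D2 *m <<u>>%MS = l *: u.
  by apply/sub_rVP; rewrite (submx_trans (submxMl _ _)) ?genmxE.
have [l0|l0] := eqVneq l 0.
  by apply: iBK iK; rewrite Hc Hl l0 scale0r addr0 submxMl.
case/negP: (uU (Some (f, K))); rewrite /U KJ dK /= -(eqmx_scale _ l0) -Hl.
rewrite -[D2 *m _](addKr (D1 *m B)) -Hc addmx_sub //.
  by rewrite eqmx_opp (submx_trans (submxMl _ _)) ?addsmxSl.
by apply/sub_ext; exists c; rewrite subrr sub0mx.
Qed.

Theorem generic_cone_connected B J : tuples_genpos B J -> (d + 1 <= #|J| + \rank B)%N -> cone_connected B J.
Proof.
have [n] := ubnP (d - \rank B)%N; elim: n => // n IHn in B J * => Bn gJ dJ u f g fg cf cg.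
have [uB|uB] := boolP (u <= B)%MS.
  by apply: (@cone_fill _ _ _ _ _ _ _ _ set0); rewrite ?sub0set ?set0U //; apply: cone_in.
have rB : (\rank B < d)%N.
  rewrite ltn_neqAle rank_leq_row andbT; apply: contra uB => /eqP e.
  by rewrite submx_full // /row_full e.
have IH B' J' : (\rank B < \rank B')%N -> tuples_genpos B' J' ->
    (d + 1 <= #|J'| + \rank B')%N -> cone_connected B' J'.
  by move=> rB' gJ' dJ'; apply: IHn => //; lia.
have [dB|dB] := leqP (\rank B + 2) d; last first.
  by apply: cone_connected_codim1 => //; lia.
have [f' zf' ff'] := conn_zero dJ uB cf; have [g' zg' gg'] := conn_zero dJ uB cg.
apply: (conn_trans ff'); apply: conn_trans (conn_coneT_sym gg').
have fg' : {in ~: J, f' =1 g'}.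
  by move=> i iJ; rewrite -(conn_off ff') // fg // (conn_off gg').
have [v vB gv] := gen_addsmx gJ rB.
have rv : \rank (B + <<v>>)%MS = (\rank B).+1.
  by rewrite -(rank_add1 vB); apply: eqmx_rank; apply/eqmxP; apply: adds_eqmx => //; apply: genmxE.
have zero_v h K : zeroT B K h -> zeroT (B + <<v>>)%MS K h.
  by move=> [w w0 Hw]; exists w => //; apply: submx_trans Hw (addsmxSl _ _).
pose sv (s : bool) := if s then v else - v.
have svB s : ~~ (sv s <= B)%MS by case: s; rewrite /= ?eqmx_opp.
have change := conn_change_target full gJ dJ IH dB.
(* Adjoining [v] gains the one dimension that freezing a colour costs. *)
have : conn J (zeroT (B + <<v>>)%MS) f' g'.
  apply: zero_connected => //; try exact: zero_v; last by rewrite rv; lia.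
  move=> i iJ; apply: IH; first by rewrite rv.
    by apply: gen_sub gv; apply: subsetDl.
  by rewrite rv; have := cardsD1 i J; rewrite iJ; lia.
suff H h : conn J (zeroT (B + <<v>>)%MS) f' h -> exists s, conn J (coneT B (sv s)) f' h.
  by move=> /H[s]; apply: change.
elim=> [|h0 k _ [s IHs] [j jJ [[w [w0 [i iJ wi]] Hw] hk]]].
  by exists true; apply: conn_refl.
(* A relation modulo [B + <<v>>] represents some [l *: v] modulo [B]; the sign of [l] selects the
   target, and for [l = 0] the cone is everything. *)
have {w w0 i iJ wi Hw} [s' cs'] : exists s', coneT B (sv s') (J :\ j) h0.
  have /sub_addsmxP[[D1 D2] /= Hc] := Hw.
  have [l Hl] : exists l : R, D2 *m <<v>>%MS = l *: v.
    by apply/sub_rVP; rewrite (submx_trans (submxMl _ _)) ?genmxE.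
  have cl : coneT B (l *: v) (J :\ j) h0.
    exists w => //; rewrite -Hl Hc opprD addrCA subrr addr0 eqmx_opp; exact: submxMl.
  have [lp|ln|l0] := ltrgt0P l.
  - exists true; have := coneZ (_ : 0 <= l^-1) cl.
    by rewrite scalerA mulVf ?gt_eqF // scale1r invr_ge0 => /(_ (ltW lp)).
  - exists false; have := coneZ (_ : 0 <= - l^-1) cl.
    by rewrite scalerA mulNr mulVf ?lt_eqF // scaleN1r oppr_ge0 invr_le0 => /(_ (ltW ln)).
  - exists true; apply: (@genpos_zero _ _ _ _ (J :\ j)).
      by apply: gen_sub gJ _; apply: subsetDl.
    exists w; first by split=> //; exists i.
    by rewrite Hc Hl l0 scale0r addr0 submxMl.
exists s'; apply: (@conn_step _ _ _ _ _ h0); last by exists j.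
(* When the sign changes, [h0] has both [v] and [- v] in its cone, hence a relation, and the path so
   far can be converted to the other target. *)
have [<-//|ss'] := eqVneq s s'.
have c1 : coneT B (sv s) J h0.
  apply: conn_inv IHs; [exact: coneT_local | exact: coneT_mono | exact: gen_zero zf'].
have c2 : coneT B (sv s') J h0 by apply: coneT_mono cs'; apply: subsetDl.
apply: (change (sv s)) => //.
apply: (zero_opp vB).
  by case: s s' ss' c1 c2 {IHs cs'} => -[].
by case: s s' ss' c1 c2 {IHs cs'} => -[].
Qed.

Theorem generic_zero_connected J f g : tuples_genpos 0 J -> (d + 2 <= #|J|)%N ->
  {in ~: J, f =1 g} -> zeroT 0 J f -> zeroT 0 J g -> conn J (zeroT 0) f g.
Proof.
move=> gJ dJ; apply: zero_connected => //; last by rewrite mxrank0 addn0.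
move=> i iJ; apply: generic_cone_connected.
  by apply: gen_sub gJ; apply: subsetDl.
by rewrite mxrank0 addn0; have := cardsD1 i J; rewrite iJ; lia.
Qed.

End Generic.

(** * Perturbation to general position *)

Section Perturbation.
Variables (R : realType) (d : nat).
Local Notation V := 'rV[R]_d.

Definition near (X : Type) (e : R) (p q : X -> V) :=
  forall x k, `|q x 0 k - p x 0 k| < e.

(** For [0 < d], the dual form of [0] being interior to the convex hull. *)
Definition surround (X : Type) (p : X -> V) :=
  forall y : 'cV[R]_d, y != 0 -> exists x, dot (p x) y < 0.

Lemma dot_le (v : V) y e : (forall k, `|v 0 k| <= e) -> `|dot v y| <= e * \sum_k `|y k 0|.
Proof.
move=> ve; rewrite /dot mxE (le_trans (ler_norm_sum _ _ _)) // mulr_sumr.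
by apply: ler_sum => k _; rewrite normrM ler_wpM2r.
Qed.

Lemma near_dot (X : Type) e (p q : X -> V) x y : near e p q ->
  `|dot (q x) y - dot (p x) y| <= e * \sum_k `|y k 0|.
Proof. by move=> pq; rewrite -dotB; apply: dot_le => k; rewrite !mxE ltW. Qed.

Lemma dot_eq0 (y : 'cV[R]_d) : dot y^T y = 0 -> y = 0.
Proof.
rewrite /dot mxE => /eqP; rewrite psumr_eq0 => [/allP H|k _]; last by rewrite mxE -expr2 sqr_ge0.
apply/colP => k; rewrite !mxE; have := H k (mem_index_enum _).
by rewrite mxE -expr2 sqrf_eq0 => /eqP.
Qed.

Section Fin.
Variable X : finType.
Implicit Types (p q : X -> V) (K S : {set X}).

Lemma surround_cone p v : surround p -> cone 0 setT p v.
Proof.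
move=> sp; have [//|/farkas [y [_ ys yv]]] := pselect (cone 0 setT p v).
have y0 : y != 0 by apply: contraTneq yv => ->; rewrite /dot mulmx0 mxE ltxx.
by have [x] := sp y y0; rewrite ltNge ys ?inE.
Qed.

Lemma surround_zero p (x : X) : surround p -> zero 0 setT p.
Proof. by move=> sp; apply: (@zero_cone_opp _ _ _ _ _ _ x); rewrite ?inE //; apply: surround_cone. Qed.

Lemma indep_eq (B : 'M[R]_d) S p q : {in S, p =1 q} -> indep B S p -> indep B S q.
Proof.
move=> pq iS c Hc; apply: iS; rewrite (eq_bigr (fun i => c i *: q i)) // => i iS.
by rewrite pq.
Qed.

Lemma generic_perturb p e : 0 < e ->
  exists2 q, near e p q & forall S, (#|S| <= d)%N -> indep 0 S q.
Proof.
move=> e0; have [d0|dp] := posnP d.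
  exists p => [x k|S]; first by rewrite subrr normr0.
  by rewrite [X in (_ <= X)%N]d0 leqn0 cards_eq0 => /eqP-> c _ i; rewrite inE.
suff H : forall D : {set X}, exists2 q, near e p q &
    forall S, S \subset D -> (#|S| <= d)%N -> indep 0 S q.
  by have [q pq iq] := H setT; exists q => // S; apply: iq.
apply: set_ind => [|i D iD [q pq iq]].
  exists p => [x k|S]; first by rewrite subrr normr0.
  by rewrite subset0 => /eqP-> _ c _ i; rewrite inE.
pose U S : 'M[R]_d := if (S \subset D) && (#|S| < d)%N then ext 0 S q else 0.
have [S|u [up uU]] := @avoid_subspaces R d _ U (p i) e _ e0.
  rewrite /U; case: ifP => [/andP[SD Sd]|_]; last by rewrite mxrank0.
  by rewrite rank_ext ?mxrank0 //; apply: iq => //; apply: ltnW.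
exists (fun x => if x == i then u else q x) => [x k|S SD Sd].
  by case: eqP => [->|_]; [apply: up | apply: pq].
have [iS|iS] := boolP (i \in S); last first.
  apply: (@indep_eq _ _ q) => [x xS|]; first by case: eqP => // xi; rewrite -xi xS in iS.
  apply: iq => //; apply/subsetP => x xS; have := subsetP SD x xS; rewrite !inE.
  by case: eqP => // xi; rewrite -xi xS in iS.
have S'D : S :\ i \subset D by rewrite subDset.
have S'd : (#|S :\ i| < d)%N by have := cardsD1 i S; rewrite iS; lia.
move=> c; rewrite (big_setD1 i) //= eqxx (eq_bigr (fun x => c x *: q x)); last first.
  by move=> x; rewrite !inE => /andP[/negbTE->].
move=> Hc.
have ci : c i = 0.
  have := uU (S :\ i); rewrite /U S'D S'd /=.
  apply: contraNeq => ci; rewrite -(eqmx_scale _ ci); apply/sub_ext.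
  by exists (fun x => - c x); under eq_bigr do rewrite scaleNr; rewrite sumrN opprK.
rewrite ci scale0r add0r in Hc => x xS; have [->//|xi] := eqVneq x i.
by apply: (iq _ S'D (ltnW S'd) _ Hc); rewrite !inE xi.
Qed.

(** Without a relation, each point of [K] has a functional positive at it and nonnegative on [K];
    their sum is positive on [K] and remains so for nearby families, which excludes relations
    there. *)
Lemma zero_stable K p :
  exists2 e0, 0 < e0 & forall e, 0 < e <= e0 -> forall q, near e p q -> zero 0 K q -> zero 0 K p.
Proof.
have [z|nz] := pselect (zero 0 K p); first by exists 1.
have sep i : exists y, i \in K -> (forall j, j \in K -> 0 <= dot (p j) y) /\ 0 < dot (p i) y.
  have [iK|_] := boolP (i \in K); last by exists 0.
  have /farkas[y [_ ys yi]] : ~ cone 0 K p (- p i) by move=> /(zero_cone_opp iK).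
  by exists y => _; split=> //; rewrite -oppr_lt0 -dotN.
pose y := \sum_(i in K) projT1 (cid (sep i)).
have yp i : i \in K -> 0 < dot (p i) y.
  move=> iK; rewrite /dot mulmx_sumr summxE (bigD1 i) //=.
  rewrite ltr_pwDl //; first by case: cid => yi /= /(_ iK) [].
  by apply: sumr_ge0 => j /andP[jK _]; case: cid => yj /= /(_ jK) [+ _]; apply.
have [i|e0 e0p He] := @uniform_eps R X (fun i e => i \in K -> e * \sum_k `|y k 0| < dot (p i) y).
  have [/yp iK|_] := boolP (i \in K); last by exists 1.
  have Np : 0 < (\sum_k `|y k 0| + 1) by rewrite ltr_wpDl // sumr_ge0.
  exists (dot (p i) y / (\sum_k `|y k 0| + 1)); first by rewrite divr_gt0.
  by move=> e /andP[ep]; rewrite ler_pdivlMr // mulrDr mulr1; lra.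
exists e0 => // e ee q pq [w [w0 [i iK wi]] Hw]; exfalso.
have qy j : j \in K -> 0 < dot (q j) y.
  move=> jK; have := near_dot j y pq; have := He j e ee jK.
  by rewrite ler_norml => + /andP[+ _]; lra.
have := dot_sub (mul0mx _ y) Hw; rewrite dot_sum (bigD1 i) //= => /eqP.
rewrite gt_eqF // ltr_pwDl ?dotZ ?mulr_gt0 ?qy // sumr_ge0 // => j /andP[jK _].
by rewrite dotZ mulr_ge0 // ltW // qy.
Qed.

(** Signed unit vectors are nonnegative combinations of the [p i]. The one opposing the largest
    coordinate of [y], of size [m], pairs to [- m]; the weights transferred to [q] alter this by at
    most [e] times their sum times [d * m], which is less than [m]. *)
Lemma surround_stable p : surround p ->
  exists2 e0, 0 < e0 & forall e, 0 < e <= e0 -> forall q, near e p q -> surround q.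
Proof.
move=> sp.
pose t (s : bool) : R := if s then 1 else -1.
have H (x : 'I_d * bool) : exists w : X -> R, (forall i, 0 <= w i) /\
    t x.2 *: delta_mx 0 x.1 = \sum_i w i *: p i.
  have [w w0] := surround_cone (t x.2 *: delta_mx 0 x.1) sp.
  rewrite submx0 subr_eq0 => /eqP Hw; exists w; split=> //; rewrite Hw.
  by apply: eq_bigl => i; rewrite inE.
pose w x := projT1 (cid (H x)).
have w0 x i : 0 <= w x i by rewrite /w; case: cid => ? [].
have wp x : t x.2 *: delta_mx 0 x.1 = \sum_i w x i *: p i by rewrite /w; case: cid => ? [].
have [x|e0 e0p He] := @uniform_eps R _ (fun x e => e * ((\sum_i w x i) * d%:R) < 1).
  have Np : 0 < (\sum_i w x i) * d%:R + 1 :> R by rewrite ltr_wpDl // mulr_ge0 // sumr_ge0.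
  exists ((\sum_i w x i) * d%:R + 1)^-1; first by rewrite invr_gt0.
  by move=> e /andP[ep]; rewrite -[_^-1]mul1r ler_pdivlMr // mulrDr mulr1; lra.
exists e0 => // e ee q pq y y0; apply/not_existsP => Hy.
have qy i : 0 <= dot (q i) y by rewrite leNgt; apply/negP/Hy.
have [k0 _] : exists k : 'I_d, y k 0 != 0.
  apply/not_existsP => yk; move/eqP: y0; apply; apply/colP => k; rewrite mxE.
  by apply/eqP/negbNE/negP/yk.
case: (@Order.TotalTheory.arg_maxP _ _ _ k0 xpredT (fun k => `|y k 0|) isT) => k _ kmax.
pose m := `|y k 0|.
have m0 : 0 < m.
  rewrite lt_def normr_ge0 andbT; apply: contra y0 => /eqP m0; apply/eqP/colP => l.
  by rewrite mxE; apply/eqP; rewrite -normr_le0; have := kmax l isT; rewrite -/m m0.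
pose x := (k, y k 0 < 0).
have tx : dot (t x.2 *: delta_mx 0 x.1) y = - m.
  rewrite dotZ /dot mxE (bigD1 k) //= mxE !eqxx big1 ?addr0 => [|l lk]; last first.
    by rewrite mxE (negbTE lk) andbF mul0r.
  rewrite mul1r /t /m; case: ltrP => yk; first by rewrite ltr0_norm // mul1r opprK.
  by rewrite ger0_norm // mulN1r.
have ep : 0 < e by case/andP: ee.
have sm : \sum_l `|y l 0| <= d%:R * m.
  rewrite -[d in d%:R]card_ord -sum1_card natr_sum mulr_suml; apply: ler_sum => l _.
  by rewrite mul1r; apply: kmax.
have : 0 <= \sum_i w x i * dot (q i) y by apply: sumr_ge0 => i _; rewrite mulr_ge0.
apply/negP; rewrite -ltNge.
apply: (@le_lt_trans _ _ (\sum_i (w x i * dot (p i) y + w x i * (e * (d%:R * m))))).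
  apply: ler_sum => i _; rewrite -mulrDr ler_wpM2l //.
  have := near_dot i y pq; rewrite ler_norml => /andP[_].
  have em : e * \sum_l `|y l 0| <= e * (d%:R * m) by rewrite ler_pM2l.
  by move: em; set s1 := e * _; set s2 := e * _; lra.

rewrite big_split /= -mulr_suml.
have -> : \sum_i w x i * dot (p i) y = - m.
  by rewrite -tx wp dot_sum; apply: eq_bigr => i _; rewrite dotZ.
have := He x e ee; rewrite -(ltr_pM2r m0) mul1r => Hm.
rewrite addrC subr_lt0 (le_lt_trans _ Hm) // le_eqVlt; apply/orP; left; apply/eqP; ring.
Qed.

(** The points other than [i0] are made generic, hence spanning, and [i0] is placed so that [0] is a
    combination with all coefficients positive. A functional nonnegative on every point then
    vanishes on a spanning set. *)
Lemma surround_perturb p e : (d < #|X|)%N -> zero 0 setT p -> 0 < e ->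
  exists2 q, near e p q & surround q.
Proof.
move=> dX [w [w0 [i0 _ wi0]]]; rewrite submx0 (big_setD1 i0) ?inE //= => /eqP Hw e0.
pose D := [set: X] :\ i0.
(* The last bound controls the displacement of [i0]: for [c <= 1], the summand of [i] changes by at
   most [c] times [w i + |p i 0 k| + 1]. *)
have [k|c cp Hc] := @uniform_eps R 'I_d (fun k c => c <= 1 /\ c <= e /\
   c * ((w i0)^-1 * \sum_(i in D) (w i + `|p i 0 k| + 1)) < e).
  set M := (w i0)^-1 * _.
  have M0 : 0 <= M.
    by rewrite mulr_ge0 ?invr_ge0 // sumr_ge0 // => i _; rewrite !addr_ge0.
  have M1 : 0 < M + 1 by rewrite ltr_wpDl.
  exists (Num.min 1 (Num.min e (e / (M + 1)))).
    by rewrite !lt_min ltr01 e0 divr_gt0.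
  move=> c /andP[cp]; rewrite !le_min => /and3P[c1 ce]; rewrite ler_pdivlMr // => cM.
  by split=> //; split=> //; move: cM; rewrite mulrDr mulr1; lra.
have {}Hc k := Hc k c; rewrite cp lexx in Hc.
have [q0 pq iq] := generic_perturb p cp.
(* Adding [c] makes even the vanishing weights strictly positive. *)
pose z := - (w i0)^-1 *: \sum_(i in D) (w i + c) *: q0 i.
exists (fun i => if i == i0 then z else q0 i) => [x k|y y0].
  have [c1 [ce cM]] := Hc k isT.
  case: eqP => [->|_]; last exact: lt_le_trans ce.
  have pi0 : p i0 = - (w i0)^-1 *: \sum_(i in D) w i *: p i.
    rewrite -[p i0]scale1r -(mulVf (lt0r_neq0 wi0)) -scalerA scaleNr -scalerN.
    by congr (_ *: _); apply/eqP; rewrite -addr_eq0 Hw.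
  have -> : z 0 k - p i0 0 k =
     - (w i0)^-1 * \sum_(i in D) ((w i + c) * q0 i 0 k - w i * p i 0 k).
    rewrite pi0 /z !mxE -mulrBr; congr (_ * _); rewrite !summxE -sumrB.
    by apply: eq_bigr => i _; rewrite !mxE.
  rewrite normrM normrN (@gtr0_norm _ (_^-1)) ?invr_gt0 //.
  apply: le_lt_trans cM; rewrite mulrCA ler_wpM2l ?invr_ge0 // mulr_sumr.
  rewrite (le_trans (ler_norm_sum _ _ _)) //; apply: ler_sum => i _.
  have -> : (w i + c) * q0 i 0 k - w i * p i 0 k =
      w i * (q0 i 0 k - p i 0 k) + c * ((q0 i 0 k - p i 0 k) + p i 0 k) by ring.
  rewrite (le_trans (ler_normD _ _)) // !normrM (ger0_norm (w0 i)) (gtr0_norm cp).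
  have pqk := ltW (pq i k).
  rewrite -[w i + _ + _]addrA mulrDr lerD //.
    by rewrite [leRHS]mulrC ler_wpM2l.
  rewrite ler_pM2l // (le_trans (ler_normD _ _)) // [leRHS]addrC lerD2r.
  exact: le_trans c1.
apply/not_existsP => Hy.
set v := (fun i => if i == i0 then z else q0 i) in Hy.
have vy i : 0 <= dot (v i) y by rewrite leNgt; apply/negP/Hy.
have vz i : i \in D -> dot (q0 i) y = 0.
  move=> iD.
  have Dq j : j \in D -> v j = q0 j by rewrite /v !inE => /andP[/negbTE->].
  have S0 : \sum_(j in D) (w j + c) * dot (q0 j) y = 0.
    apply/eqP; rewrite eq_le; apply/andP; split; last first.
      by apply: sumr_ge0 => j jD; rewrite mulr_ge0 ?addr_ge0 ?(ltW cp) // -Dq.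
    have := vy i0; rewrite /v eqxx /z dotZ dot_sum mulNr oppr_ge0 pmulr_rle0 ?invr_gt0 //.
    by congr (_ <= _); apply: eq_bigr => j _; rewrite dotZ.
  move/eqP: S0; rewrite psumr_eq0 => [/allP /(_ i (mem_index_enum _))|j jD].
    rewrite iD /= mulf_eq0 => /orP[|/eqP //]; rewrite gt_eqF //.
    by rewrite ltr_wpDl.
  by rewrite mulr_ge0 ?addr_ge0 ?(ltW cp) // -Dq.
case/negP: y0; apply/eqP/dot_eq0.
have : (y^T <= ext 0 D q0)%MS.
  apply: ext_full; first by move=> K _; rewrite mxrank0 addn0; apply: iq.
  rewrite mxrank0 addn0 /D; have := cardsD1 i0 [set: X]; rewrite inE cardsT.
  by move: dX; lia.
case/sub_ext => a; rewrite submx0 subr_eq0 => /eqP->.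
by rewrite dot_sum big1 // => i iD; rewrite dotZ vz // mulr0.
Qed.

End Fin.
End Perturbation.

(** * From convex hulls to relations, and jointly generic colours *)

Section Assembly.
Variables (R : realType) (d : nat).
Local Notation V := 'rV[R]_d.

Lemma in_conv_fam_zero (C : finType) (a : C -> V) x :
  in_conv_fam predT a x -> zero 0 setT (fun i => a i - x).
Proof.
move=> [w [w0 [w1 wx]]]; exists w; last first.
  rewrite submx0 (eq_bigl predT) => [|i]; last by rewrite inE.
  under eq_bigr do rewrite scalerBr.
  by rewrite sumrB -scaler_suml w1 scale1r -wx subrr.
split=> //; apply/not_exists2P => H.
have : \sum_i w i = 0.
  apply: big1 => i _; apply: le_anti; rewrite w0 andbT leNgt; apply/negP => wi.
  by case: (H i).
by rewrite w1 => /eqP; rewrite oner_eq0.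
Qed.

Lemma zero_in_conv_fam (C : finType) (K : {set C}) (Q : pred C) (a : C -> V) x :
  (forall i, Q i = (i \in K)) -> zero 0 K (fun i => a i - x) -> in_conv_fam Q a x.
Proof.
move=> QK [w [w0 [i iK wi]]]; rewrite submx0; under eq_bigr do rewrite scalerBr.
rewrite sumrB subr_eq0 -scaler_suml => /eqP Hw.
set s := \sum_(i in K) w i in Hw.
have s0 : 0 < s by rewrite /s (bigD1 i) //= ltr_pwDl // sumr_ge0.
exists (fun i => s^-1 * w i); split; first by move=> j; rewrite mulr_ge0 // invr_ge0 ltW.
rewrite !(eq_bigl _ _ QK) -mulr_sumr mulVf ?gt_eqF //; split=> //.
under eq_bigr do rewrite -scalerA.
by rewrite -scaler_sumr Hw scalerA mulVf ?gt_eqF // scale1r.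
Qed.

Variables (C T : finType).

Lemma generic_colors (P : C -> T -> V) e : 0 < e ->
  exists2 Q : C -> T -> V, (forall j, near e (P j) (Q j)) & tuples_genpos Q 0 setT.
Proof.
move=> e0; have [q pq iq] := generic_perturb (fun x : C * T => P x.1 x.2) e0.
exists (fun j t => q (j, t)) => [j t k|f K _]; first exact: (pq (j, t)).
rewrite mxrank0 addn0 => dK c Hc i iK.
have inj : {in K &, injective (fun i => (i, f i))} by move=> ? ? _ _ [].
have := iq ((fun i => (i, f i)) @: K) _ (fun x => c x.1).
rewrite card_in_imset // (big_imset _ inj) /= => /(_ dK Hc (i, f i)); apply.
by apply/imsetP; exists i.
Qed.

End Assembly.

(** * Copies of the given points and transfer of paths *)

Section Copies.
Variables (R : realType) (d n : nat) (A : 'I_n -> seq 'rV[R]_d) (x : 'rV[R]_d).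
Hypothesis xA : forall i, in_conv (A i) x.
Variables (a b : 'I_n -> 'rV[R]_d).
Hypotheses (va : rgcc_vertex A x a) (vb : rgcc_vertex A x b).

(* Indices of the perturbed points of a colour: [inl (k, l, s)] is the [k]-th point moved along
   the [l]-th axis with sign [s]; [inr true] and [inr false] are the points of the two tuples. *)
Definition copy : finType := ('I_(\max_i size (A i)) * 'I_d * bool + bool)%type.

(** Colours of different sizes share one index type; an index past the end of [A j] falls back on
    its first point. *)
Definition base (j : 'I_n) (t : copy) : 'rV[R]_d :=
  match t with
  | inl (k, _, _) => nth ((A j)`_0) (A j) k
  | inr s => if s then a j else b j
  end.

Lemma baseA j t : base j t \in A j.
Proof.
have Aj : (0 < size (A j))%N.
  have [w [_ [w1 _]]] := xA j; rewrite lt0n; apply/eqP => A0.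
  move/eqP: w1; rewrite big1 1?eq_sym ?oner_eq0 // => -[k kA].
  by exfalso; rewrite A0 in kA.
case: t => [[[k l] s]|s] /=; last by case: s; [case: va | case: vb].
have [kA|kA] := ltnP k (size (A j)); first exact: mem_nth.
by rewrite nth_default // mem_nth.
Qed.

Lemma base_dot_le0 j (y : 'cV[R]_d) : exists k : 'I_(\max_i size (A i)),
  dot (nth ((A j)`_0) (A j) k - x) y <= 0.
Proof.
apply/not_existsP => H.
have /in_conv_fam_zero [w [w0 [i _ wi]] Hw] := xA j.
have pos k : 0 < dot ((A j)`_(k : 'I_(size (A j))) - x) y.
  have kn : (k < \max_i size (A i))%N by rewrite (leq_trans (ltn_ord k)) // leq_bigmax.
  rewrite ltNge; apply/negP => kle; apply: (H (Ordinal kn)) => /=.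
  by rewrite (set_nth_default 0).
have := dot_sub (mul0mx _ y) Hw; rewrite dot_sum (bigD1 i) ?inE //= => /eqP.
rewrite gt_eqF // ltr_pwDl ?dotZ ?mulr_gt0 // sumr_ge0 // => k _.
by rewrite dotZ mulr_ge0 // ltW.
Qed.

Definition rel_base (j : 'I_n) (t : copy) := base j t - x.

Lemma exists_copies e : 0 < e -> (d < n)%N ->
  exists P : 'I_n -> copy -> 'rV[R]_d,
  [/\ forall j, near e (rel_base j) (P j), tuples_genpos P 0 setT,
      forall j v, cone 0 setT (P j) v &
      forall s, zero 0 setT (fun j => P j (inr s))].
Proof.
move=> e0 dn.
have tup s : exists v : 'I_n -> 'rV[R]_d, near (e / 2) (fun j => rel_base j (inr s)) v /\ surround v.
  have [|||v nv sv] := @surround_perturb _ _ _ (fun j => rel_base j (inr s)) (e / 2).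
  - by rewrite card_ord.
  - by case: s; apply: in_conv_fam_zero; [case: va | case: vb].
  - by rewrite divr_gt0.
  by exists v.
pose v s := projT1 (cid (tup s)).
have nv s : near (e / 2) (fun j => rel_base j (inr s)) (v s) by rewrite /v; case: cid => ? [].
have sv s : surround (v s) by rewrite /v; case: cid => ? [].
pose P1 (j : 'I_n) (t : copy) : 'rV[R]_d :=
  match t with
  | inl (k, l, s) => rel_base j t + (if s then e / 4 else - (e / 4)) *: delta_mx 0 l
  | inr s => v s j
  end.
have nP j : near (e / 2) (rel_base j) (P1 j).
  move=> [[[k l] s]|s] m; last exact: nv.
  rewrite /P1; move: (rel_base _ _) => r; rewrite !mxE addrAC subrr add0r normrM (_ : `|if s then _ else _| = e / 4); last first.
    by case: s; rewrite ?normrN gtr0_norm // divr_gt0.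
  by rewrite eqxx /=; case: eqP => _; rewrite ?normr1 ?normr0; lra.
(* Some point of the colour pairs nonpositively with [y]; its copy shifted against the sign of a
   nonzero coordinate of [y] pairs negatively. *)
have sP j : surround (P1 j).
  move=> y y0; have [k Hk] := base_dot_le0 j y.
  have [l yl] : exists l : 'I_d, y l 0 != 0.
    apply/not_existsP => yk; move/eqP: y0; apply; apply/colP => l; rewrite mxE.
    by apply/eqP/negbNE/negP/yk.
  exists (inl (k, l, y l 0 < 0)); rewrite /P1 dotD dotZ.
  have -> : dot (delta_mx 0 l) y = y l 0 by rewrite /dot -rowE mxE.
  rewrite /rel_base /=; have e4 : 0 < e / 4 by rewrite divr_gt0.
  case: (ltrP (y l 0) 0) => yl0.
    by have := nmulr_llt0 (e / 4) yl0; rewrite e4 => H; lra.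
  have yp : 0 < y l 0 by rewrite lt_def yl.
  by have := mulr_gt0 e4 yp; lra.
have [j|e1 e1p H1] := @uniform_eps R 'I_n (fun j c => forall q, near c (P1 j) q -> surround q).
  exact: surround_stable.
have [s|e2 e2p H2] := @uniform_eps R bool (fun s c => forall q, near c (v s) q -> surround q).
  exact: surround_stable.
(* The first displacement used less than [e / 2]; the generic one takes at most the other half and
   stays within both stability thresholds. *)
pose c := Num.min (e / 2) (Num.min e1 e2).
have cp : 0 < c by rewrite !lt_min e1p e2p divr_gt0.
have [ce [c1 c2]] : c <= e / 2 /\ c <= e1 /\ c <= e2.
  by rewrite /c !ge_min !lexx !orbT.
have [P nP1 gP] := generic_colors P1 cp.
exists P; split=> //.
- move=> j t k; have := nP j t k; have := nP1 j t k.
  have -> : P j t 0 k - rel_base j t 0 k = (P j t 0 k - P1 j t 0 k) + (P1 j t 0 k - rel_base j t 0 k).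
    by rewrite addrA subrK.
  by move=> Ha Hb; rewrite (le_lt_trans (ler_normD _ _)) //; lra.
- move=> j u; apply: surround_cone; apply: (H1 j c) => //; exact/andP.
- move=> s; have n0 : (0 < n)%N by apply: leq_ltn_trans dn.
  apply: (surround_zero (Ordinal n0)); apply: (H2 s c); first exact/andP.
  by move=> j k; apply: (nP1 j (inr s)).
Qed.

Lemma path_of_conn (f g : {ffun 'I_n -> copy}) :
  rgcc_vertex A x (fun j => base j (f j)) ->
  conn setT (zeroT rel_base 0) f g ->
  exists k (p : nat -> 'I_n -> 'rV[R]_d),
    [/\ p 0%N = (fun j => base j (f j)), p k = (fun j => base j (g j)),
      forall m, (m <= k)%N -> rgcc_vertex A x (p m) &
      forall m, (m < k)%N -> rgcc_adj x (p m) (p m.+1)].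
Proof.
move=> vf; elim=> [|g' h _ [k [p [p0 pk vp ap]]] [j _ [zj gh]]].
  by exists 0%N, (fun _ => (fun j => base j (f j))).
(* Different copies may lie over the same point; such an exchange is no edge of the graph and is
   skipped. *)
have [e|ne] := pselect ((fun i => base i (g' i)) = (fun i => base i (h i))).
  by exists k, p; rewrite -e.
exists k.+1, (fun m => if (m <= k)%N then p m else fun i => base i (h i)).
split; rewrite ?ltnn //.
- move=> m _; case: leqP => [/vp//|_]; split=> [i|]; first exact: baseA.
  apply: (@zero_in_conv_fam _ _ _ setT) => [i|]; first by rewrite in_setT.
  apply: (zero_sub (subsetT (setT :\ j))); apply: zero_eq zj => i.
  by rewrite !inE andbT => ij; rewrite /rel_base /pt gh ?inE.
- move=> m; rewrite ltnS => mk; rewrite mk; case: ltnP => [/ap//|km].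
  have -> : m = k by apply/eqP; rewrite eqn_leq mk.
  rewrite pk; exists j; split; [|split].
  + move=> e; apply: ne; apply: funext => i; have [->//|ij] := eqVneq i j.
    by rewrite gh ?inE.
  + by move=> i ij; rewrite gh ?inE.
  + by apply: zero_in_conv_fam zj => i; rewrite !inE andbT.
Qed.

End Copies.

Theorem theorem7p5 (R : realType) (d n : nat) (A : 'I_n -> seq 'rV[R]_d)
    (x : 'rV[R]_d) :
  (forall i, in_conv (A i) x) ->
  (d + 2 <= n)%N ->
  rgcc_connected A x.
Proof.
move=> xA dn a b va vb.
(* One threshold for all tuples and all sets of colours, so that every relation met on the perturbed
   path descends to the original points. *)
have [[f K]|e e0 He] := @uniform_eps R ({ffun 'I_n -> copy A} * {set 'I_n})%type (fun y c =>
    forall q, near c (pt (rel_base x a b) y.1) q -> zero 0 y.2 q ->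
    zeroT (rel_base x a b) 0 y.2 y.1).
  exact: zero_stable.
have [|P [nP gP fP zP]] := exists_copies xA va vb e0; first by lia.
pose c s : {ffun 'I_n -> copy A} := [ffun => inr s].
have zc s : zeroT P 0 setT (c s).
  by apply: zero_eq (zP s) => j _; rewrite /pt ffunE.
have cn : conn setT (zeroT P 0) (c true) (c false).
  by apply: generic_zero_connected => // [|j]; rewrite ?cardsT ?card_ord // !inE.
have cb s : (fun j => base a b j (c s j)) = if s then a else b.
  by apply: funext => j; rewrite ffunE; case: s.
have [||k [p [p0 pk vp ap]]] := @path_of_conn _ _ _ A x xA a b va vb (c true) (c false).
- by rewrite cb.
- apply: conn_incl cn => // j h _ _ zh; apply: (He (h, _) e) zh; first by rewrite e0 lexx.
  by move=> i k; apply: nP.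
by exists k, p; rewrite p0 pk !cb.
Qed.
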